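(* Every principal $2$-bundle over a discrete Lie groupoid admits a connection: if $\mathbb{G}=[G_1\rightrightarrows G_0]$ is a Lie $2$-group, $X$ is a manifold and $\mathbb{E}=[E_1\rightrightarrows E_0]$ is a principal $\mathbb{G}$-bundle over the discrete Lie groupoid $[X\rightrightarrows X]$, then there exists a strict connection $1$-form on $\mathbb{E}$.
   Context: Manifolds are smooth, Hausdorff and second countable. In a Lie groupoid, source and target are surjective submersions. The discrete Lie groupoid $[X\rightrightarrows X]$ has only identity morphisms. A Lie $2$-group $\mathbb{G}=[G_1\rightrightarrows G_0]$ is a strict group object in Lie groupoids: $G_0,G_1$ are Lie groups and all groupoid structure maps are homomorphisms. A principal $\mathbb{G}$-bundle over a Lie groupoid $\mathbb{X}=[X_1\rightrightarrows X_0]$ is a morphism of Lie groupoids $\pi\colon\mathbb{E}\to\mathbb{X}$ with a morphism of Lie groupoids $\mathbb{E}\times\mathbb{G}\to\mathbb{E}$ whose components are right Lie group actions of $G_i$ on $E_i$, such that $\pi_i\colon E_i\to X_i$ is a principal $G_i$-bundle, $i=0,1$. $L(G_i)$ is the Lie algebra of $G_i$; $L(\mathbb{G})=[L(G_1)\rightrightarrows L(G_0)]$ and the tangent groupoid $T\mathbb{E}=[TE_1\rightrightarrows TE_0]$ have structure maps the differentials of those of $\mathbb{G}$ (at $e$) and $\mathbb{E}$. A strict connection $1$-form on $\mathbb{E}$ is a morphism of Lie groupoids $\omega=(\omega_1,\omega_0)\colon T\mathbb{E}\to L(\mathbb{G})$ such that each $\omega_i$ is a connection $1$-form on the principal $G_i$-bundle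 $E_i\to X_i$, i.e. an $L(G_i)$-valued $1$-form with $\omega_i(v\cdot g)=\mathrm{ad}_{g^{-1}}\omega_i(v)$ and $\omega_i(\delta_x(B))=B$ for $B\in L(G_i)$, where $\delta_x$ is the differential at $e$ of $g\mapsto xg$ and $\mathrm{ad}$ is the adjoint action on the Lie algebra. *)

(* Defs.v *)
From HB Require Import structures.
From mathcomp Require Import all_boot all_order all_algebra.
From mathcomp Require Import all_classical all_reals.
From mathcomp Require Import interval_inference topology normedtype landau derive.

Set Implicit Arguments.
Unset Strict Implicit.
Unset Printing Implicit Defensive.

Import Order.TTheory GRing.Theory Num.Theory.
Import numFieldNormedType.Exports.

Local Open Scope classical_set_scope.
Local Open Scope ring_scope.

(* Meant for an open set [A]: [f] is C^(k+1) on [A] iff it is Frechet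
   differentiable on [A] and all its directional derivatives are C^k on [A]. *)
Fixpoint Ck {R : numFieldType} {V W : normedModType R} (k : nat)
    (A : set V) (f : V -> W) : Prop :=
  if k is k'.+1 then
    (forall x, A x -> differentiable f x) /\
    (forall v, Ck k' A (fun x => 'd f x v))
  else forall x, A x -> {for x, continuous f}.

Definition Cinf {R : numFieldType} {V W : normedModType R}
    (A : set V) (f : V -> W) : Prop := forall k, Ck k A f.

Section Ck_product.
Context {R : realType}.

Lemma differentiable_nearE (V W : normedModType R) (f g : V -> W) (x : V) :
  (\forall y \near x, f y = g y) -> differentiable f x ->
  differentiable g x /\ 'd g x = 'd f x :> (V -> W).
Proof.
move=> fg df.
have fgx : f x = g x by exact: nbhs_singleton fg.
have fg0 : \forall h \near 0, f (h + x) = g (h + x).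
  have h0 : (fun h : V => h + x) @ 0 --> x.
    rewrite -[X in _ --> X]add0r; apply: cvgD; first exact: cvg_id.
    exact: cvg_cst.
  exact: h0 fg.
have expg : g \o shift x = cst (g x) + 'd f x +o_ 0 id.
  apply/eqaddoP => _/posnumP[e].
  have /eqaddoP /(_ e%:num) := diff_locally df.
  move=> /(_ [gt0 of e%:num]) H.
  by apply: filterS2 H fg0 => h; rewrite !fctE /= -fgx => + <-.
have dE : 'd g x = 'd f x :> (V -> W).
  by apply: diff_unique expg; exact: diff_continuous.
split=> //; apply/diff_locallyP; rewrite dE; split=> //.
exact: diff_continuous.
Qed.

Lemma Ck_ext (V W : normedModType R) k (A : set V) (f g : V -> W) :
  open A -> (forall x, A x -> f x = g x) -> Ck k A f -> Ck k A g.
Proof.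
move=> oA; elim: k f g => [|k IH] f g fg /=.
  move=> cf x Ax; rewrite /prop_for /continuous_at -(fg x Ax).
  apply: cvg_trans (cf x Ax); apply: near_eq_cvg.
  by apply: filterS (open_nbhs_nbhs (conj oA Ax)) => y /fg ->.
move=> [df ddf].
have fgn x : A x -> \forall y \near x, f y = g y.
  by move=> Ax; apply: filterS (open_nbhs_nbhs (conj oA Ax)) => y /fg ->.
split=> [x Ax|v]; first by have [] := differentiable_nearE (fgn x Ax) (df x Ax).
apply: IH (ddf v) => x Ax.
by have [_ ->] := differentiable_nearE (fgn x Ax) (df x Ax).
Qed.

Definition row_mxp {m n} (p : 'rV[R]_m * 'rV[R]_n) : 'rV[R]_(m + n) :=
  row_mx p.1 p.2.

Lemma row_mxp_is_linear m n : linear (@row_mxp m n).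
Proof. by move=> a [u1 u2] [v1 v2]; rewrite /row_mxp scale_row_mx add_row_mx. Qed.

HB.instance Definition _ m n := GRing.isLinear.Build R
  ('rV[R]_m * 'rV[R]_n)%type 'rV[R]_(m + n) _ (@row_mxp m n)
  (@row_mxp_is_linear m n).

Lemma row_mxp_continuous m n : continuous (@row_mxp m n).
Proof.
move=> [u v] A /nbhs_ballP[e /= e0 eA].
apply/nbhs_ballP; exists e => //= -[u' v'] [/= [_ uu] [_ vv]].
apply: eA; split=> // i j; rewrite /row_mxp !mxE.
by case: split_ordP.
Qed.

Lemma differentiable_row_mxp m n p : differentiable (@row_mxp m n) p.
Proof. exact/linear_differentiable/row_mxp_continuous. Qed.

Lemma Ck_row_mx m n m' n' k (A : set 'rV[R]_m) (B : set 'rV[R]_n)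
    (f : 'rV[R]_m -> 'rV[R]_m') (g : 'rV[R]_n -> 'rV[R]_n') :
  open A -> open B -> Ck k A f -> Ck k B g ->
  Ck k [set y : 'rV[R]_(m + n) | A (lsubmx y) /\ B (rsubmx y)]
    (fun y => row_mx (f (lsubmx y)) (g (rsubmx y))).
Proof.
move=> oA oB.
have oAB : open [set y : 'rV[R]_(m + n) | A (lsubmx y) /\ B (rsubmx y)].
  apply: openI.
  - by apply: open_comp => // y _; exact: continuous_lsubmx.
  - by apply: open_comp => // y _; exact: continuous_rsubmx.
elim: k f g => [|k IH] f g /=.
  move=> cf cg y [Ay By].
  have cfl : f (lsubmx z) @[z --> y] --> f (lsubmx y).
    exact: (cvg_comp lsubmx f (@continuous_lsubmx _ _ _ _ y) (cf _ Ay)).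
  have cgr : g (rsubmx z) @[z --> y] --> g (rsubmx y).
    exact: (cvg_comp rsubmx g (@continuous_rsubmx _ _ _ _ y) (cg _ By)).
  exact: (cvg_comp _ (@row_mxp m' n') (cvg_pair cfl cgr)
    (@row_mxp_continuous m' n' (_, _))).
move=> [df ddf] [dg ddg].
have dl y : A (lsubmx y) -> differentiable (f \o @lsubmx R 1 m n) y.
  by move=> Ay; apply: differentiable_comp; [exact: differentiable_lsubmx|exact: df].
have dr y : B (rsubmx y) -> differentiable (g \o @rsubmx R 1 m n) y.
  by move=> By; apply: differentiable_comp; [exact: differentiable_rsubmx|exact: dg].
split=> [y [Ay By]|v].
  apply: (@differentiable_comp _ _ _ _
    (fun y => ((f \o lsubmx) y, (g \o rsubmx) y)) (@row_mxp m' n')).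
    by apply: differentiable_pair; [exact: dl | exact: dr].
  exact: differentiable_row_mxp.
apply: Ck_ext oAB _ (IH _ _ (ddf (lsubmx v)) (ddg (rsubmx v))) => y [Ay By].
have -> : (fun y => row_mx (f (lsubmx y)) (g (rsubmx y))) =
    @row_mxp m' n' \o (fun y => ((f \o lsubmx) y, (g \o rsubmx) y)) by [].
have dp : differentiable (fun y => ((f \o lsubmx) y, (g \o rsubmx) y)) y.
  by apply: differentiable_pair; [exact: dl | exact: dr].
rewrite (diff_comp dp (differentiable_row_mxp _)).
rewrite (diff_lin _ (@row_mxp_continuous m' n')) /= (diff_pair (dl _ Ay) (dr _ By)).
rewrite (diff_comp (differentiable_lsubmx y) (df _ Ay)).
rewrite (diff_comp (differentiable_rsubmx y) (dg _ By)) /row_mxp /=.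
rewrite (diff_lin _ (@continuous_lsubmx _ _ _ _)).
by rewrite (diff_lin _ (@continuous_rsubmx _ _ _ _)).
Qed.

End Ck_product.

Record chart (R : realType) (T : topologicalType) (n : nat) := Chart {
  cdom : set T;
  ccod : set 'rV[R]_n;
  cto : T -> 'rV[R]_n;
  cinv : 'rV[R]_n -> T;
  cdom_open : open cdom;
  ccod_open : open ccod;
  cto_ccod : forall x, cdom x -> ccod (cto x);
  cinv_cdom : forall y, ccod y -> cdom (cinv y);
  ctoK : forall x, cdom x -> cinv (cto x) = x;
  cinvK : forall y, ccod y -> cto (cinv y) = y;
  cto_continuous : forall x, cdom x -> {for x, continuous cto};
  cinv_continuous : forall y, ccod y -> {for y, continuous cinv} }.

(* The field [chart_at] selects an atlas chart around each point. It is no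
   extra structure up to diffeomorphism; it provides coordinates for the
   tangent spaces below. *)
Record manifold (R : realType) := Manifold {
  mcarrier :> topologicalType;
  mdim : nat;
  atlas : set (chart R mcarrier mdim);
  chart_at : mcarrier -> chart R mcarrier mdim;
  chart_at_atlas : forall x, atlas (chart_at x);
  chart_at_cdom : forall x, cdom (chart_at x) x;
  atlas_compat : forall phi psi, atlas phi -> atlas psi ->
    Cinf [set y | ccod phi y /\ cdom psi (cinv phi y)] (cto psi \o cinv phi);
  manifold_hausdorff : hausdorff_space mcarrier;
  manifold_second_countable : @second_countable mcarrier }.

Section smooth_maps.
Context {R : realType}.

(* Meant for an open set [U]. *)
Definition smooth_on (M N : manifold R) (U : set M) (f : M -> N) : Prop :=
  (forall x, U x -> {for x, continuous f}) /\
  (forall phi psi, @atlas R M phi -> @atlas R N psi ->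
    Cinf [set y | [/\ ccod phi y, U (cinv phi y) & cdom psi (f (cinv phi y))]]
      (cto psi \o f \o cinv phi)).

Definition smooth (M N : manifold R) (f : M -> N) : Prop :=
  @smooth_on M N setT f.

(* A tangent vector at [x] is recorded by its coordinates in [chart_at x]. The
   type does not depend on [x], so that no transport is needed between the
   tangent spaces at two provably equal points. *)
Definition tangent (M : manifold R) (x : M) : lmodType R := 'rV[R]_(mdim M).

Definition tdiff (M N : manifold R) (f : M -> N) (x : M) (v : tangent x) :
    tangent (f x) :=
  'd (cto (chart_at (f x)) \o f \o cinv (chart_at x)) (cto (chart_at x) x) v.

Definition surjective_submersion (M N : manifold R) (f : M -> N) : Prop :=
  [/\ @smooth M N f,
      (forall y, exists x, f x = y) &
      (forall x (w : tangent (f x)), exists v : tangent x, @tdiff M N f x v = w)].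

(* The tangent vector at [cinv phi y] with coordinates [v] in the chart [phi]:
   (y, v) |-> (cinv phi y, tangent_inv phi y v) is the inverse of the chart of
   the tangent bundle induced by [phi]. *)
Definition tangent_inv (M : manifold R) (phi : chart R M (mdim M))
    (y v : 'rV[R]_(mdim M)) : tangent (cinv phi y) :=
  'd (cto (chart_at (cinv phi y)) \o cinv phi) y v.

(* [P] with [p], [q] is the fibre product of [f] and [g] in manifolds, with
   the set-theoretic fibre product as underlying set. *)
Definition is_fibre_product (M N B P : manifold R) (f : M -> B) (g : N -> B)
    (p : P -> M) (q : P -> N) : Prop :=
  [/\ @smooth P M p, @smooth P N q,
      (forall z, f (p z) = g (q z)),
      (forall x y, f x = g y -> exists! z, p z = x /\ q z = y) &
      (forall (Z : manifold R) (h : Z -> P),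
        @smooth Z M (p \o h) -> @smooth Z N (q \o h) -> @smooth Z P h)].

End smooth_maps.

Arguments smooth_on {R} M N U f.
Arguments smooth {R} M N f.
Arguments tangent {R} M x.
Arguments tdiff {R} M N f x v.
Arguments surjective_submersion {R} M N f.
Arguments tangent_inv {R} M phi y v.
Arguments is_fibre_product {R} M N B P f g p q.

Section product.
Context {R : realType}.

Section prod_chart.
Variables (S T : topologicalType) (m n : nat).
Variables (phi : chart R S m) (psi : chart R T n).

Let pto (x : S * T) : 'rV[R]_(m + n) := row_mx (cto phi x.1) (cto psi x.2).
Let pinv (y : 'rV[R]_(m + n)) : S * T :=
  (cinv phi (lsubmx y), cinv psi (rsubmx y)).
Let pdom : set (S * T) := [set x | cdom phi x.1 /\ cdom psi x.2].
Let pcod : set 'rV[R]_(m + n) :=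
  [set y | ccod phi (lsubmx y) /\ ccod psi (rsubmx y)].

Let pdom_open : open pdom.
Proof.
apply: openI.
- exact: (@open_comp _ _ fst _ (fun x _ => cvg_fst) (cdom_open phi)).
- exact: (@open_comp _ _ snd _ (fun x _ => cvg_snd) (cdom_open psi)).
Qed.

Let pcod_open : open pcod.
Proof.
apply: openI.
- by apply: open_comp => [y _|]; [exact: continuous_lsubmx|exact: ccod_open].
- by apply: open_comp => [y _|]; [exact: continuous_rsubmx|exact: ccod_open].
Qed.

Let pto_pcod x : pdom x -> pcod (pto x).
Proof.
by move=> [? ?]; rewrite /pcod /pto /= row_mxKl row_mxKr; split; exact: cto_ccod.
Qed.

Let pinv_pdom y : pcod y -> pdom (pinv y).
Proof. by move=> [? ?]; split; exact: cinv_cdom. Qed.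

Let ptoK x : pdom x -> pinv (pto x) = x.
Proof.
by case: x => x y [? ?]; rewrite /pinv /pto row_mxKl row_mxKr /= !ctoK.
Qed.

Let pinvK y : pcod y -> pto (pinv y) = y.
Proof. by move=> [? ?]; rewrite /pinv /pto /= !cinvK// hsubmxK. Qed.

Let pto_continuous x : pdom x -> {for x, continuous pto}.
Proof.
move=> [x1 x2].
have c1 : cto phi z.1 @[z --> x] --> cto phi x.1.
  exact: (cvg_comp fst (cto phi) cvg_fst (cto_continuous x1)).
have c2 : cto psi z.2 @[z --> x] --> cto psi x.2.
  exact: (cvg_comp snd (cto psi) cvg_snd (cto_continuous x2)).
exact: (cvg_comp _ (@row_mxp R m n) (cvg_pair c1 c2)
  (@row_mxp_continuous R m n (_, _))).
Qed.

Let pinv_continuous y : pcod y -> {for y, continuous pinv}.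
Proof.
move=> [y1 y2].
have c1 : cinv phi (lsubmx z) @[z --> y] --> cinv phi (lsubmx y).
  exact: (cvg_comp lsubmx _ (@continuous_lsubmx _ _ _ _ y) (cinv_continuous y1)).
have c2 : cinv psi (rsubmx z) @[z --> y] --> cinv psi (rsubmx y).
  exact: (cvg_comp rsubmx _ (@continuous_rsubmx _ _ _ _ y) (cinv_continuous y2)).
exact: (cvg_pair c1 c2).
Qed.

Definition prod_chart : chart R (S * T)%type (m + n) :=
  Chart pdom_open pcod_open pto_pcod pinv_pdom ptoK pinvK
    pto_continuous pinv_continuous.

End prod_chart.

Lemma prod_hausdorff (S T : topologicalType) :
  hausdorff_space S -> hausdorff_space T -> hausdorff_space (S * T)%type.
Proof.
move=> hS hT [x1 x2] [y1 y2] xy; congr pair.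
- apply: hS => A B xA yB.
  have [||z [Az Bz]] := xy (fst @^-1` A) (fst @^-1` B).
  + exact: (cvg_fst xA).
  + exact: (cvg_fst yB).
  + by exists z.1.
- apply: hT => A B xA yB.
  have [||z [Az Bz]] := xy (snd @^-1` A) (snd @^-1` B).
  + exact: (cvg_snd xA).
  + exact: (cvg_snd yB).
  + by exists z.2.
Qed.

Lemma prod_second_countable (S T : topologicalType) :
  @second_countable S -> @second_countable T ->
  @second_countable (S * T)%type.
Proof.
move=> [B cB [oB bB]] [C cC [oC bC]].
exists [set p.1 `*` p.2 | p in B `*` C].
  by apply: card_le_trans (card_image_le _ _) _; exact: countableX.
split.
  move=> _ [[U V] [/= /oB oU /oC oV] <-].
  apply: openI.
  - exact: (@open_comp _ _ fst _ (fun x _ => cvg_fst) oU).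
  - exact: (@open_comp _ _ snd _ (fun x _ => cvg_snd) oV).
move=> [x y] A [[P Q] [/= /bB[U [BU Ux] UP] /bC[V [CV Vy] VQ]] PQA].
exists (U `*` V); last by move=> [a b] [/= /UP ? /VQ ?]; exact: PQA.
by split=> //; exists (U, V).
Qed.

Definition prod_manifold (M N : manifold R) : manifold R.
Proof.
refine (@Manifold R (M * N)%type (mdim M + mdim N)
  [set phi | exists a b, [/\ @atlas R M a, @atlas R N b & phi = prod_chart a b]]
  (fun x => prod_chart (chart_at x.1) (chart_at x.2)) _ _ _ _ _).
- move=> x; exists (chart_at x.1), (chart_at x.2).
  by split=> //; exact: chart_at_atlas.
- by move=> x; split; exact: chart_at_cdom.
- move=> _ _ [a [b [Aa Ab ->]]] [a' [b' [Aa' Ab' ->]]] k.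
  have open_cap (S : topologicalType) n (phi psi : chart R S n) :
      open [set y | ccod phi y /\ cdom psi (cinv phi y)].
    rewrite openE => y [py qy]; apply: filterI.
      by apply: open_nbhs_nbhs; split; [exact: ccod_open|].
    apply: (cinv_continuous py); apply: open_nbhs_nbhs.
    by split=> //; exact: cdom_open.
  have := Ck_row_mx (open_cap _ _ a a') (open_cap _ _ b b')
    (atlas_compat Aa Aa' k) (atlas_compat Ab Ab' k).
  congr (Ck _ _ _); apply/seteqP; split=> y /=; first by move=> [[? ?] [? ?]].
  by move=> [[? ?] [? ?]].
- by apply: prod_hausdorff; exact: manifold_hausdorff.
- by apply: prod_second_countable; exact: manifold_second_countable.
Defined.

End product.

Arguments prod_manifold {R} M N.

Record lie_group (R : realType) := LieGroup {
  lie_group_manifold :> manifold R;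
  gmul : lie_group_manifold -> lie_group_manifold -> lie_group_manifold;
  gone : lie_group_manifold;
  ginv : lie_group_manifold -> lie_group_manifold;
  gmulA : forall x y z, gmul x (gmul y z) = gmul (gmul x y) z;
  gmul1g : forall x, gmul gone x = x;
  gmulg1 : forall x, gmul x gone = x;
  gmulVg : forall x, gmul (ginv x) x = gone;
  gmulgV : forall x, gmul x (ginv x) = gone;
  gmul_smooth : smooth (prod_manifold lie_group_manifold lie_group_manifold)
    lie_group_manifold (fun p => gmul p.1 p.2);
  ginv_smooth : smooth lie_group_manifold lie_group_manifold ginv }.

Arguments gone {R} l.

Section lie_groups.
Context {R : realType}.

Definition ghom (G H : lie_group R) (f : G -> H) : Prop :=
  forall x y, f (gmul x y) = gmul (f x) (f y).

Definition lie_algebra (G : lie_group R) : lmodType R := tangent G (gone G).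

(* The value lies in the tangent space at g^-1 1 g = 1. *)
Definition ad_inv (G : lie_group R) (g : G) : lie_algebra G -> lie_algebra G :=
  tdiff G G (fun a => gmul (gmul (ginv g) a) g) (gone G).

Record right_lie_action (G : lie_group R) (E : manifold R)
    (act : E -> G -> E) : Prop := RightLieAction {
  act_smooth : smooth (prod_manifold E G) E (fun p => act p.1 p.2);
  act1 : forall x, act x (gone G) = x;
  actM : forall x g h, act x (gmul g h) = act (act x g) h }.

Record principal_bundle (G : lie_group R) (E X : manifold R)
    (proj : E -> X) (act : E -> G -> E) : Prop := PrincipalBundle {
  pb_action : right_lie_action act;
  pb_smooth : smooth E X proj;
  pb_fibre : forall x g, proj (act x g) = proj x;
  pb_trivial : forall b : X, exists (U : set X)
      (h : E -> prod_manifold X G) (k : prod_manifold X G -> E),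
    [/\ open U /\ U b,
        smooth_on E (prod_manifold X G) (proj @^-1` U) h,
        smooth_on (prod_manifold X G) E (fst @^-1` U) k,
        (forall x, U (proj x) ->
          [/\ k (h x) = x, (h x).1 = proj x &
              forall g, h (act x g) = ((h x).1, gmul (h x).2 g)]) &
        (forall p, U p.1 -> proj (k p) = p.1 /\ h (k p) = p)] }.

(* Smoothness is that of [omega], seen as a map TE -> L(G), in the charts of TE
   induced by those of E. *)
Record connection_form (G : lie_group R) (E : manifold R) (act : E -> G -> E)
    (omega : forall x : E, tangent E x -> lie_algebra G) : Prop :=
  ConnectionForm {
  conn_linear : forall x, linear (omega x);
  conn_smooth : forall phi, @atlas R E phi ->
    Cinf [set p : 'rV[R]_(mdim E) * 'rV[R]_(mdim E) | ccod phi p.1]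
      (fun p => omega (cinv phi p.1) (tangent_inv E phi p.1 p.2)
                  : 'rV[R]_(mdim G));
  conn_equivariant : forall x g (v : tangent E x),
    omega (act x g) (tdiff E E (fun y => act y g) x v) = ad_inv g (omega x v);
  conn_vertical : forall x (B : lie_algebra G),
    omega x (tdiff G E (act x) (gone G) B) = B }.

End lie_groups.

(* Arrows [X1], objects [X0]. The composition [comp_arr c] of [c], standing for
   the pair (a, b) = (comp_fst c, comp_snd c) with src a = tgt b, is "a after b".
   The manifold of composable pairs is determined up to a unique diffeomorphism
   by [composable_fibre_product]; it exists since [src] is a submersion. *)
Record lie_groupoid (R : realType) (X1 X0 : manifold R) := LieGroupoid {
  src : X1 -> X0;
  tgt : X1 -> X0;
  unit_arr : X0 -> X1;
  inv_arr : X1 -> X1;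
  composable : manifold R;
  comp_fst : composable -> X1;
  comp_snd : composable -> X1;
  comp_arr : composable -> X1;
  src_submersion : surjective_submersion X1 X0 src;
  tgt_submersion : surjective_submersion X1 X0 tgt;
  unit_smooth : smooth X0 X1 unit_arr;
  inv_smooth : smooth X1 X1 inv_arr;
  composable_fibre_product :
    is_fibre_product X1 X1 X0 composable src tgt comp_fst comp_snd;
  comp_smooth : smooth composable X1 comp_arr;
  src_unit : forall x, src (unit_arr x) = x;
  tgt_unit : forall x, tgt (unit_arr x) = x;
  src_comp : forall c, src (comp_arr c) = src (comp_snd c);
  tgt_comp : forall c, tgt (comp_arr c) = tgt (comp_fst c);
  comp_unitl : forall c, comp_fst c = unit_arr (tgt (comp_snd c)) ->
    comp_arr c = comp_snd c;
  comp_unitr : forall c, comp_snd c = unit_arr (src (comp_fst c)) ->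
    comp_arr c = comp_fst c;
  (* c = (a1, a2), d = (a2, a3), c' = (a1 a2, a3), d' = (a1, a2 a3) *)
  compA : forall c d c' d', comp_snd c = comp_fst d ->
    comp_fst c' = comp_arr c -> comp_snd c' = comp_snd d ->
    comp_fst d' = comp_fst c -> comp_snd d' = comp_arr d ->
    comp_arr c' = comp_arr d';
  src_inv : forall a, src (inv_arr a) = tgt a;
  tgt_inv : forall a, tgt (inv_arr a) = src a;
  comp_invl : forall c, comp_fst c = inv_arr (comp_snd c) ->
    comp_arr c = unit_arr (src (comp_snd c));
  comp_invr : forall c, comp_snd c = inv_arr (comp_fst c) ->
    comp_arr c = unit_arr (tgt (comp_fst c)) }.

Section discrete.
Context {R : realType}.
Variable X : manifold R.

Lemma smooth_id : smooth X X id.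
Proof.
split=> [x _|phi psi Aphi Apsi k]; first exact: cvg_id.
have := atlas_compat Aphi Apsi k.
by congr (Ck _ _ _); apply/seteqP; split=> y /= => [[]|[]].
Qed.

Lemma tdiff_id (x : X) (v : tangent X x) : tdiff X X id x v = v.
Proof.
rewrite /tdiff; set phi := chart_at x.
have idE : \forall y \near cto phi x, idfun y = (cto phi \o id \o cinv phi) y.
  have : nbhs (cto phi x) (ccod phi).
    apply: open_nbhs_nbhs; split; first exact: ccod_open.
    exact/cto_ccod/chart_at_cdom.
  by apply: filterS => y py; rewrite /= cinvK.
have dlin : differentiable (idfun : 'rV[R]_(mdim X) -> _) (cto phi x).
  by apply: linear_differentiable => ?; exact: cvg_id.
have [_ ->] := differentiable_nearE idE dlin.
by rewrite diff_lin // => ?; exact: cvg_id.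
Qed.

Lemma submersion_id : surjective_submersion X X id.
Proof.
split; [exact: smooth_id|by move=> y; exists y|].
by move=> x w; exists w; exact: tdiff_id.
Qed.

Lemma fibre_product_id : is_fibre_product X X X X id id id id.
Proof.
split; [exact: smooth_id|exact: smooth_id|by []| |by []].
by move=> x y /= <-; exists x; split=> // z [].
Qed.

Definition discrete_groupoid : lie_groupoid X X.
Proof.
refine (@LieGroupoid R X X id id id id X id id id
  submersion_id submersion_id smooth_id smooth_id fibre_product_id smooth_id
  _ _ _ _ _ _ _ _ _ _ _) => //=.
by move=> c d c' d' cd c'c c'd d'c d'd; rewrite c'c d'c.
Defined.

End discrete.

Record lie_2group (R : realType) (G1 G0 : lie_group R) := Lie2Group {
  lie_2group_groupoid :> lie_groupoid G1 G0;
  src_hom : ghom (src lie_2group_groupoid);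
  tgt_hom : ghom (tgt lie_2group_groupoid);
  unit_hom : ghom (unit_arr lie_2group_groupoid);
  inv_hom : ghom (inv_arr lie_2group_groupoid);
  comp_hom : forall c d e : composable lie_2group_groupoid,
    comp_fst e = gmul (comp_fst c) (comp_fst d) ->
    comp_snd e = gmul (comp_snd c) (comp_snd d) ->
    comp_arr e = gmul (comp_arr c) (comp_arr d) }.

Section two_bundles.
Context {R : realType}.

Record groupoid_morphism (X1 X0 Y1 Y0 : manifold R) (X : lie_groupoid X1 X0)
    (Y : lie_groupoid Y1 Y0) (f1 : X1 -> Y1) (f0 : X0 -> Y0) : Prop :=
  GroupoidMorphism {
  gm_smooth1 : smooth X1 Y1 f1;
  gm_smooth0 : smooth X0 Y0 f0;
  gm_src : forall a, src Y (f1 a) = f0 (src X a);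
  gm_tgt : forall a, tgt Y (f1 a) = f0 (tgt X a);
  gm_unit : forall x, f1 (unit_arr X x) = unit_arr Y (f0 x);
  gm_comp : forall (c : composable X) (d : composable Y),
    comp_fst d = f1 (comp_fst c) -> comp_snd d = f1 (comp_snd c) ->
    f1 (comp_arr c) = comp_arr d }.

(* [ga_src] to [ga_comp] say that ([act1], [act0]) is a morphism of Lie
   groupoids E x G -> E; smoothness is part of [right_lie_action]. *)
Record groupoid_action (G1 G0 : lie_group R) (G : lie_2group G1 G0)
    (E1 E0 : manifold R) (E : lie_groupoid E1 E0)
    (act1 : E1 -> G1 -> E1) (act0 : E0 -> G0 -> E0) : Prop := GroupoidAction {
  ga_action1 : right_lie_action act1;
  ga_action0 : right_lie_action act0;
  ga_src : forall a g, src E (act1 a g) = act0 (src E a) (src G g);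
  ga_tgt : forall a g, tgt E (act1 a g) = act0 (tgt E a) (tgt G g);
  ga_unit : forall x g,
    act1 (unit_arr E x) (unit_arr G g) = unit_arr E (act0 x g);
  ga_comp : forall (c d : composable E) (g : composable G),
    comp_fst d = act1 (comp_fst c) (comp_fst g) ->
    comp_snd d = act1 (comp_snd c) (comp_snd g) ->
    act1 (comp_arr c) (comp_arr g) = comp_arr d }.

Record principal_2bundle (G1 G0 : lie_group R) (G : lie_2group G1 G0)
    (X1 X0 : manifold R) (X : lie_groupoid X1 X0)
    (E1 E0 : manifold R) (E : lie_groupoid E1 E0) := Principal2Bundle {
  bundle_proj1 : E1 -> X1;
  bundle_proj0 : E0 -> X0;
  action1 : E1 -> G1 -> E1;
  action0 : E0 -> G0 -> E0;
  p2b_proj : groupoid_morphism E X bundle_proj1 bundle_proj0;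
  p2b_action : groupoid_action G E action1 action0;
  p2b_principal1 : principal_bundle bundle_proj1 action1;
  p2b_principal0 : principal_bundle bundle_proj0 action0 }.

(* Graph of the composition of the tangent groupoid TX: the pairs of
   composable tangent vectors, TX1 x_{TX0} TX1, are the tangent vectors to the
   manifold of composable pairs. *)
Definition tangent_comp (X1 X0 : manifold R) (X : lie_groupoid X1 X0)
    (a : X1) (v : tangent X1 a) (b : X1) (w : tangent X1 b)
    (c : X1) (z : tangent X1 c) : Prop :=
  exists (p : composable X) (xi : tangent (composable X) p),
    [/\ comp_fst p = a, comp_snd p = b & comp_arr p = c] /\
    [/\ tdiff (composable X) X1 (@comp_fst _ _ _ X) p xi = v,
        tdiff (composable X) X1 (@comp_snd _ _ _ X) p xi = w &
        tdiff (composable X) X1 (@comp_arr _ _ _ X) p xi = z].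

(* [sc_src] to [sc_comp] say that ([omega1], [omega0]) is a morphism of
   groupoids TE -> L(G); smoothness is [conn_smooth]. *)
Record strict_connection (G1 G0 : lie_group R) (G : lie_2group G1 G0)
    (X1 X0 : manifold R) (X : lie_groupoid X1 X0)
    (E1 E0 : manifold R) (E : lie_groupoid E1 E0) (P : principal_2bundle G X E)
    (omega1 : forall a : E1, tangent E1 a -> lie_algebra G1)
    (omega0 : forall x : E0, tangent E0 x -> lie_algebra G0) : Prop :=
  StrictConnection {
  sc_form1 : connection_form (action1 P) omega1;
  sc_form0 : connection_form (action0 P) omega0;
  sc_src : forall a (v : tangent E1 a),
    tdiff G1 G0 (src G) (gone G1) (omega1 a v) =
    omega0 (src E a) (tdiff E1 E0 (src E) a v);
  sc_tgt : forall a (v : tangent E1 a),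
    tdiff G1 G0 (tgt G) (gone G1) (omega1 a v) =
    omega0 (tgt E a) (tdiff E1 E0 (tgt E) a v);
  sc_unit : forall x (v : tangent E0 x),
    omega1 (unit_arr E x) (tdiff E0 E1 (unit_arr E) x v) =
    tdiff G0 G1 (unit_arr G) (gone G0) (omega0 x v);
  sc_comp : forall a (v : tangent E1 a) b (w : tangent E1 b)
      c (z : tangent E1 c),
    tangent_comp E v w z ->
    @tangent_comp _ _ G (gone G1) (omega1 a v) (gone G1) (omega1 b w)
      (gone G1) (omega1 c z) }.

End two_bundles.

(* Main.v *)
From HB Require Import structures.
From mathcomp Require Import all_boot all_order all_algebra.
From mathcomp Require Import all_classical all_reals.
From mathcomp Require Import interval_inference topology normedtype derive.
From mathcomp Require Import realfun sequences exp.
From mathcomp Require Import ring lra.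
Require Import Defs.

(* Over a small open U the bundle has an equivariant morphism of groupoids
   gamma = (gamma1, gamma0) to G: a local section s of E0 and the units of its
   values trivialize E0 and E1 compatibly, and gamma1 a is the g with
   a = u(s(pi a)) g. Pulling back the Maurer-Cartan forms, that is, setting
   omega_x(v) = d_x(y |-> gamma(x)^-1 gamma(y))(v), gives a strict connection
   over U. All structure maps of E cover the identity of X, so the conditions on
   a strict connection are affine over the functions on X, and local connections
   can be glued with a partition of unity on X. From a countable cover with
   smooth rho_n supported in trivializing opens and equal to 1 on open sets V_n
   that cover X, the functions rho_n (1 - rho_0) ... (1 - rho_(n-1)) form one:
   all those of index greater than n vanish on V_n, so no paracompactness
   argument is needed, and they sum to 1 although they need not be positive. *)

Set Implicit Arguments.
Unset Strict Implicit.
Unset Printing Implicit Defensive.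

Import Order.TTheory GRing.Theory Num.Theory.
Import numFieldNormedType.Exports.

Local Open Scope classical_set_scope.
Local Open Scope ring_scope.

(** * Calculus of C^k maps *)

(** A function on the objects of a base groupoid has two pullbacks to the arrows, along source and
    target, and in general they differ, so weights would destroy compatibility with [src] and [tgt].
    Over a discrete base both are the pullback along the projection, and averaging is harmless. The
    analytic work comes from two encodings: tangent vectors are coordinates in a chart that may jump
    from point to point, and composable pairs are known only through a universal property. The first
    is met by differentiating one smooth map on E x E along the diagonal, the second by lifting maps
    through a retraction. *)

Section Ck_calculus.
Context {R : realType}.
Implicit Types U V W : normedModType R.

Lemma Ck_continuous V W k (A : set V) (f : V -> W) :
  Ck k A f -> forall x, A x -> {for x, continuous f}.
Proof.
by case: k => [//|k] [df _] x /df; exact: differentiable_continuous.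
Qed.

Lemma Ck_sub V W k (A B : set V) (f : V -> W) :
  A `<=` B -> Ck k B f -> Ck k A f.
Proof.
move=> AB; elim: k f => [|k IH] f /=; first by move=> cf x /AB /cf.
by move=> [df ddf]; split=> [x /AB /df//|v]; exact/IH/ddf.
Qed.

Lemma Ck_local V W k (A : set V) (f : V -> W) :
  (forall x, A x -> exists B, B x /\ Ck k B f) -> Ck k A f.
Proof.
elim: k f => [|k IH] f H /=.
  by move=> x Ax; have [B [Bx Bf]] := H x Ax; exact: Bf.
split=> [x /H[B [Bx [df _]]]|v]; first exact: df.
by apply: IH => x /H[B [Bx [_ Bf]]]; exists B; split=> //; exact: Bf.
Qed.

Lemma CkW V W k (A : set V) (f : V -> W) : Ck k.+1 A f -> Ck k A f.
Proof.
elim: k f => [|k IH] f; first by move=> /Ck_continuous.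
by move=> [df ddf]; split=> // v; exact: IH.
Qed.

Lemma Ck_cst V W k (A : set V) (c : W) : Ck k A (cst c).
Proof.
elim: k c => [|k IH] c /=; first by move=> x _; exact: cst_continuous.
split=> [x _|v]; first exact: differentiable_cst.
rewrite (_ : (fun x => _) = cst 0); first exact: IH.
by apply/funext => x; rewrite diff_cst.
Qed.

Lemma Ck_linear V W k (A : set V) (f : {linear V -> W}) :
  continuous f -> Ck k A f.
Proof.
move=> cf; case: k => [x _|k]; first exact: cf.
split=> [x _|v]; first exact: linear_differentiable.
rewrite (_ : (fun x => _) = cst (f v)); first exact: Ck_cst.
by apply/funext => x; rewrite diff_lin.
Qed.

Lemma Ck_linear_comp U V W k (A : set U) (f : U -> V) (g : {linear V -> W}) :
  open A -> continuous g -> Ck k A f -> Ck k A (g \o f).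
Proof.
move=> oA cg; elim: k f => [|k IH] f.
  by move=> cf x Ax; apply: continuous_comp; [exact: cf|exact: cg].
move=> [df ddf]; have dg y := linear_differentiable y cg.
split=> [x /df ?|v]; first exact: differentiable_comp.
apply: Ck_ext oA _ (IH _ (ddf v)) => x Ax.
by rewrite diff_comp//=; [rewrite diff_lin|exact: df].
Qed.

Lemma CkD V W k (A : set V) (f g : V -> W) :
  open A -> Ck k A f -> Ck k A g -> Ck k A (f \+ g).
Proof.
move=> oA; elim: k f g => [|k IH] f g /=.
  by move=> cf cg x Ax; apply: continuousD; [exact: cf|exact: cg].
move=> [df ddf] [dg ddg]; split=> [x Ax|v].
  by apply: differentiableD; [exact: df|exact: dg].
apply: Ck_ext oA _ (IH _ _ (ddf v) (ddg v)) => x Ax.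
by rewrite (diffD (df x Ax) (dg x Ax)).
Qed.

Lemma Ck_sum V W k (A : set V) (I : Type) (r : seq I) (F : I -> V -> W) :
  open A -> (forall i, Ck k A (F i)) ->
  Ck k A (fun x => \sum_(i <- r) F i x).
Proof.
move=> oA H; elim: r => [|i r IH].
  by apply: Ck_ext (Ck_cst k A 0) => // x _; rewrite big_nil.
by apply: Ck_ext (CkD oA (H i) IH) => // x _; rewrite big_cons.
Qed.

Lemma scale_is_bilinear W : bilinear_for
  (GRing.Scale.Law.clone _ _ *:%R _) (GRing.Scale.Law.clone _ _ *:%R _)
  (@GRing.scale R W).
Proof.
split=> [u'|u] a x y /=; first by rewrite scalerDl scalerA.
by rewrite scalerDr !scalerA mulrC.
Qed.

HB.instance Definition _ W := bilinear_isBilinear.Build R R W W _ _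
  (@GRing.scale R W) (@scale_is_bilinear W).

(** Scaling has been registered as a bilinear map, so the product rule is the chain rule for it
    after y |-> (f y, g y). *)
Lemma differentiableZf V W (f : V -> R) (g : V -> W) x :
  differentiable f x -> differentiable g x ->
  differentiable (fun y => f y *: g y) x /\
  'd (fun y => f y *: g y) x = (fun v => f x *: 'd g x v + 'd f x v *: g x)
    :> (V -> W).
Proof.
move=> df dg.
have c : continuous (fun p : R * W => p.1 *: p.2).
  exact: scale_continuous.
have d := differentiable_bilin (f := @GRing.scale R W) (f x, g x) c.
have -> : (fun y => f y *: g y) = (fun p => p.1 *: p.2) \o (fun y => (f y, g y)).
  by [].
split; first by apply: differentiable_comp d; exact: differentiable_pair.
rewrite diff_comp//; last exact: differentiable_pair.
rewrite (diff_bilin (f := @GRing.scale R W) (f x, g x) c)/=.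
by apply/funext => v /=; rewrite (diff_pair df dg)/= .
Qed.

Lemma CkZ V W k (A : set V) (f : V -> R) (g : V -> W) :
  open A -> Ck k A f -> Ck k A g -> Ck k A (fun x => f x *: g x).
Proof.
move=> oA; elim: k f g => [|k IH] f g.
  move=> cf cg x Ax.
  exact: (@cvgZ _ _ _ _ _ f g _ _ (cf x Ax) (cg x Ax)).
move=> fk gk; have := fk; have := gk; move=> [dg ddg] [df ddf].
split=> [x Ax|v]; first by have [] := differentiableZf (df x Ax) (dg x Ax).
apply: Ck_ext oA _ (CkD oA (IH _ _ (CkW fk) (ddg v)) (IH _ _ (ddf v) (CkW gk))).
move=> x Ax /=.
by have [_ ->] := differentiableZf (df x Ax) (dg x Ax).
Qed.

Definition finite_frame W n (e : 'I_n -> W) (l : 'I_n -> {linear W -> R}) :=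
  (forall j, continuous (l j)) /\ (forall w, w = \sum_j l j w *: e j).

(* [W] is finite dimensional. As [Ck] only speaks of derivatives in fixed
   directions, the chain rule expands the moving direction ['d f x v] in a
   frame. *)
Definition has_frame W := exists n (e : 'I_n -> W) l, finite_frame e l.

Lemma Ck_comp U V W k (A : set U) (B : set V) (f : U -> V) (g : V -> W) :
  has_frame V -> open A -> (forall x, A x -> B (f x)) ->
  Ck k A f -> Ck k B g -> Ck k A (g \o f).
Proof.
move=> [n [e [l [cl lE]]]] oA AB; elim: k f g AB => [|k IH] f g AB.
  move=> cf cg x Ax; apply: continuous_comp; [exact: cf|exact/cg/AB].
move=> fk [dg ddg]; have := fk; move=> [df ddf].
split=> [x Ax|v]; first by apply: differentiable_comp; [exact: df|exact/dg/AB].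
have H j : Ck k A (fun x => l j ('d f x v) *: 'd g (f x) (e j)).
  apply: CkZ => //; first exact: Ck_linear_comp (ddf v).
  exact: IH AB (CkW fk) (ddg (e j)).
apply: Ck_ext oA _ (Ck_sum (index_enum _) oA H) => x Ax.
rewrite (diff_comp (df x Ax) (dg _ (AB x Ax)))/= [in RHS](lE ('d f x v)).
by rewrite linear_sum/=; apply: eq_bigr => j _; rewrite linearZ.
Qed.

End Ck_calculus.

Section frames.
Context {R : realType}.

Lemma has_frame_scalar : has_frame R.
Proof.
exists 1%N, (fun=> 1), (fun=> idfun); split=> [j x|w]; first exact: cvg_id.
by rewrite big_ord1 [RHS]mulr1.
Qed.

Lemma has_frame_rV n : has_frame 'rV[R]_n.
Proof.
pose c (j : 'I_n) (v : 'rV[R]_n) : R := v ord0 j.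
have lc j : linear (c j) by move=> a u v; rewrite /c !mxE.
pose l j : {linear 'rV[R]_n -> R} :=
  HB.pack (c j) (GRing.isLinear.Build _ _ _ _ _ (lc j)).
exists n, (fun j => delta_mx 0 j), l; split=> [j|w]; first exact: coord_continuous.
by rewrite [LHS]row_sum_delta.
Qed.

End frames.

(** * Plateau functions *)

Section flat_functions.
Context {R : realType}.
Implicit Types (p q : {poly R}) (t s : R).

(** Closure of the family under differentiation lets the induction on the order run over all indices
    at once. The successive derivatives of exp(-1/t) live in such a family. *)
Lemma Cinf_is_derive (I : Type) (f : I -> R -> R) (D : I -> I) :
  (forall i t, is_derive t 1 (f i) (f (D i) t)) ->
  forall i, Cinf setT (f i).
Proof.
move=> H i k; elim: k i => [|k IH] i.
  move=> t _; apply: differentiable_continuous; apply/derivable1_diffP.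
  by have [] := H i t.
have d j t : differentiable (f j) t.
  by apply/derivable1_diffP; have [] := H j t.
split=> // v.
apply: (Ck_ext openT) (CkZ openT (Ck_cst _ _ v) (IH (D i))) => t _.
by rewrite diff1E//= derive1E; have [_ ->] := H i t.
Qed.

(** The exponential series gives s^i <= i! exp(s) for s >= 0; the constant sums these bounds over
    the monomials of [p]. *)
Lemma poly_expR_bound p : exists2 C, 0 <= C &
  forall s, 0 <= s -> `|p.[s]| <= C * expR s.
Proof.
exists (\sum_(i < size p) `|p`_i| * i`!%:R); first exact: sumr_ge0.
move=> s s0; rewrite horner_coef (le_trans (ler_norm_sum _ _ _))// mulr_suml.
apply: ler_sum => i _; rewrite normrM -mulrA ler_wpM2l//.
rewrite ger0_norm ?exprn_ge0//; case: (nat_of_ord i) => [|n].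
  by rewrite expr0 fact0 mul1r -expR0 ler_expR.
rewrite -ler_pdivrMl ?ltr0n ?fact_gt0// mulrC.
by rewrite (le_trans _ (expR_ge1Dxn n s0))// lerDr.
Qed.

(** The case [p = 1] is exp(-1/t) extended by 0. The polynomial in 1/t absorbs the factors that
    differentiation produces. *)
Definition flat p t : R := if 0 < t then p.[t^-1] * expR (- t^-1) else 0.

(** Quadratic decay makes the difference quotient at 0 tend to 0. It is the exponential bound at s =
    1/t for [p * 'X^2], whose additional square supplies t^2. *)
Lemma flat_le_sqr p : exists2 C, 0 <= C & forall t, `|flat p t| <= C * t ^+ 2.
Proof.
have [C C0 HC] := poly_expR_bound (p * 'X^2); exists C => // t.
rewrite /flat; case: ifPn => t0; last by rewrite normr0 mulr_ge0 ?sqr_ge0.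
have /HC : 0 <= t^-1 by rewrite invr_ge0 ltW.
rewrite hornerM hornerXn exprVn !normrM expRN.
rewrite (ger0_norm (_ : 0 <= (t ^+ 2)^-1)) ?invr_ge0 ?sqr_ge0//.
rewrite (ger0_norm (_ : 0 <= (expR _)^-1)) ?invr_ge0 ?expR_ge0//.
rewrite ler_pdivrMr ?exprn_gt0// => H.
by rewrite ler_pdivrMr ?expR_gt0// mulrAC.
Qed.

Lemma is_derive_flat p t : is_derive t 1 (flat p) (flat ('X^2 * (p - p^`())) t).
Proof.
have [t0|t0|<-] := ltgtP 0 t.
- have -> : flat ('X^2 * (p - p^`())) t =
      p.[t^-1] * (expR (- t^-1) * t ^- 2) + expR (- t^-1) * (p^`().[t^-1] * - t ^- 2).
    rewrite /flat t0 hornerM hornerXn hornerD hornerN -exprVn; ring.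
  apply: (@near_eq_is_derive R R R (fun x => p.[x^-1] * expR (- x^-1))).
    near=> x; have x0 : 0 < x by near: x; exact: lt_nbhsr.
    by rewrite /flat x0.
  have tN0 : t != 0 by rewrite gt_eqF.
  have dV : is_derive t 1 (fun x : R => x^-1) (- t ^- 2).
    by apply: is_derive_eq (is_deriveV tN0 (is_derive_id t 1)) _; rewrite [LHS]mulr1.
  have dp : is_derive t 1 (fun x => p.[x^-1]) (p^`().[t^-1] * - t ^- 2).
    exact: (is_derive1_comp (f := horner p) (g := fun x : R => x^-1)).
  have de : is_derive t 1 (fun x => expR (- x^-1)) (expR (- t^-1) * t ^- 2).
    have dN : is_derive t 1 (fun x : R => - x^-1) (t ^- 2).
      by apply: is_derive_eq (is_deriveN dV) _; rewrite opprK.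
    exact: (is_derive1_comp (f := expR) (g := fun x : R => - x^-1)).
  exact: (is_deriveM dp de).
- rewrite {2}/flat ltNge ltW//=.
  apply: (@near_eq_is_derive R R R (cst 0)).
    near=> x; have x0 : x < 0 by near: x; exact: lt_nbhsl.
    by rewrite /flat ltNge ltW.
- rewrite {2}/flat ltxx.
  have [C C0 HC] := flat_le_sqr p.
  suff H : h^-1 *: ((flat p \o shift 0) (h *: 1) - flat p 0) @[h --> 0^'] --> (0 : R).
    by apply: DeriveDef; [apply/cvg_ex; exists 0|exact: cvg_lim].
  apply/cvgr0Pnorm_le => e e0; near=> h.
  have h0 : h != 0 by near: h; exact: nbhs_dnbhs_neq.
  rewrite /= addr0 [h *: 1]mulr1 [flat p 0]/flat ltxx subr0 normrM normfV.
  rewrite ler_pdivrMl ?normr_gt0// (le_trans (HC h))//.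
  rewrite -(real_normK (num_real h)) expr2 mulrA mulrC ler_wpM2l//.
  (* [C] may be 0, so the division is by [C + 1]. *)
  have : `|h| <= e / (C + 1).
    near: h; apply: dnbhs0_le; first by rewrite divr_gt0// ltr_wpDl.
  rewrite ler_pdivlMr ?ltr_wpDl// => H; rewrite (le_trans _ H)// mulrC.
  by rewrite ler_wpM2l// lerDl.
Unshelve. all: by end_near. Qed.

Lemma Cinf_flat p : Cinf setT (flat p).
Proof. exact: Cinf_is_derive is_derive_flat p. Qed.

(* Composing [flat 1] with itself yields a plateau without any division of
   functions. *)
Definition step t : R := expR 1 * flat 1 (1 - expR 1 * flat 1 t).

Lemma Cinf_step : Cinf setT step.
Proof.
have lin k (c : R) (f : R -> R) :
    Ck k setT f -> Ck k setT (fun x => c * f x).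
  by move=> fk; apply: CkZ => //; [exact: openT|exact: Ck_cst].
move=> k; apply: (lin).
apply: (@Ck_comp R _ _ _ k setT setT (fun t => 1 - expR 1 * flat 1 t) (flat 1)).
- exact: has_frame_scalar.
- exact: openT.
- by [].
- have -> : (fun t => 1 - expR 1 * flat 1 t) = cst 1 \+ (fun t => - expR 1 * flat 1 t).
    by apply/funext => t /=; rewrite mulNr.
  by apply: CkD; [exact: openT|exact: Ck_cst|exact/lin/Cinf_flat].
- exact: Cinf_flat.
Qed.

(** The factors [expR 1] are there for this value, since flat 1 1 = exp(-1). *)
Lemma step1 t : t <= 0 -> step t = 1.
Proof.
move=> t0; rewrite /step /flat [0 < t]ltNge t0/= mulr0 subr0 ltr01 hornerC.
by rewrite mul1r invr1 expRxMexpNx_1.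
Qed.

(** For t >= 1 one has e exp(-1/t) >= 1, so the outer [flat] is taken at a nonpositive argument. *)
Lemma step0 t : 1 <= t -> step t = 0.
Proof.
move=> t1; have t0 : 0 < t by rewrite (lt_le_trans _ t1).
rewrite /step {1}/flat ifF ?mulr0//; apply/negbTE; rewrite -leNgt subr_le0.
rewrite /flat t0 hornerC mul1r -expRD -[leLHS]expR0 ler_expR subr_ge0.
by rewrite invf_le1.
Qed.

Lemma Ck_prod (V : normedModType R) k (A : set V) (I : Type) (r : seq I)
    (F : I -> V -> R) : open A -> (forall i, Ck k A (F i)) ->
  Ck k A (fun x => \prod_(i <- r) F i x).
Proof.
move=> oA H; elim: r => [|i r IH].
  by apply: Ck_ext (@Ck_cst R V R k A 1) => // x _; rewrite big_nil.
by apply: Ck_ext (@CkZ R V R _ _ _ _ oA (H i) IH) => // x _; rewrite big_cons.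
Qed.

Lemma normr_coord_le n (y : 'rV[R]_n) j : `|y ord0 j| <= `|y|.
Proof.
have /mapP[i Hi ->] : `|y ord0 j| \in [seq `|y x.1 x.2| | x : 'I_1 * 'I_n].
  by apply/mapP; exists (ord0, j) => //=; rewrite mem_enum.
by rewrite [leRHS]/Num.norm /= mx_normrE; apply/bigmax_geP; right => /=; exists i.
Qed.

(** The norm is the maximum norm, so a product of one-variable plateaus in the coordinates works.
    Squares keep them smooth: a_j = (c_j / r)^2 - 1 is at most 0 when |c_j| <= r and at least 3 when
    |c_j| >= 2 r, beyond the threshold 1 of [step]. *)
Lemma cutoff_exists n (y0 : 'rV[R]_n) (r : R) : 0 < r ->
  exists b : 'rV[R]_n -> R, [/\ Cinf setT b,
    (forall y, `|y - y0| < r -> b y = 1) &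
    (forall y, 2 * r <= `|y - y0| -> b y = 0)].
Proof.
move=> r0.
pose c (j : 'I_n) (y : 'rV[R]_n) : R := (y - y0) ord0 j.
pose a j y := r^-1 ^+ 2 * (c j y * c j y) + (-1).
have Ca k j : Ck k setT (a j).
  have lc : linear (fun v : 'rV[R]_n => v ord0 j : R) by move=> d u v; rewrite !mxE.
  pose l : {linear 'rV[R]_n -> R} :=
    HB.pack (fun v : 'rV[R]_n => v ord0 j : R) (GRing.isLinear.Build _ _ _ _ _ lc).
  have Cc : Ck k setT (c j).
    apply: (Ck_ext openT) (CkD openT (Ck_linear _ _ (_ : continuous l))
      (Ck_cst k setT (- y0 ord0 j))) => [y _|]; last exact: coord_continuous.
    by rewrite /c !mxE.
  apply: (CkD openT) (Ck_cst _ _ _).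
  exact: CkZ openT (Ck_cst _ _ _) (CkZ openT Cc Cc).
exists (fun y => \prod_j step (a j y)); split.
- move=> k; apply: Ck_prod => [|j]; first exact: openT.
  exact: (Ck_comp has_frame_scalar openT _ (Ca k j) (Cinf_step k)).
- move=> y yr; apply: big1 => j _; apply: step1.
  rewrite subr_le0 -expr2 -exprMn mulrC -(real_normK (num_real (_ / _)))//.
  rewrite exprn_ile1// normrM normfV (gtr0_norm r0) ler_pdivrMr// mul1r.
  exact: le_trans (normr_coord_le _ _) (ltW yr).
- move=> y yr.
  (* A nonzero maximum norm is attained at some coordinate j, and the factor of that j is zero. *)
  have : mx_norm (y - y0) != 0.
    by rewrite gt_eqF// (lt_le_trans _ yr)// mulr_gt0.
  move=> /mx_norm_neq0[[i j] /= yj]; rewrite (bigD1 j)//= step0 ?mul0r//.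
  have {}yr : 2 * r <= `|c j y|.
    by rewrite /c -[ord0](ord1 i) -yj.
  rewrite lerBrDr -expr2 -exprMn mulrC -(real_normK (num_real (_ / _)))//.
  apply: (@le_trans _ _ (2 ^+ 2)); first lra.
  rewrite lerXn2r ?nnegrE// normrM normfV (gtr0_norm r0).
  by rewrite ler_pdivlMr.
Qed.

End flat_functions.

(** * Smooth maps between manifolds *)

Section smooth_calculus.
Context {R : realType}.
Implicit Types M N P : manifold R.

Lemma open_setI_preimage (S T : topologicalType) (U : set S) (f : S -> T)
    (D : set T) : open U -> (forall x, U x -> {for x, continuous f}) ->
  open D -> open (U `&` f @^-1` D).
Proof.
move=> oU cf oD; rewrite openE => x [Ux Dfx]; apply: filterI.
  exact: open_nbhs_nbhs.
by apply: (cf x Ux); exact: open_nbhs_nbhs.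
Qed.

Lemma open_chart_preimage (T : topologicalType) n (phi : chart R T n)
    (O : set T) : open O -> open [set y | ccod phi y /\ O (cinv phi y)].
Proof.
by apply: open_setI_preimage; [exact: ccod_open|exact: cinv_continuous].
Qed.

Lemma near_cinv (T : topologicalType) n (phi : chart R T n) x (O : set T) :
  cdom phi x -> (\forall y \near x, O y) ->
  \forall y \near cto phi x, ccod phi y /\ O (cinv phi y).
Proof.
move=> px Ox; have cx := cto_ccod px; apply: filterI.
  by apply: open_nbhs_nbhs; split=> //; exact: ccod_open.
by apply: (cinv_continuous cx); rewrite ctoK.
Qed.

Definition smooth_at M N (f : M -> N) (x : M) : Prop :=
  exists U, [/\ open U, U x & smooth_on M N U f].

Lemma smooth_at_continuous M N (f : M -> N) x :
  smooth_at f x -> {for x, continuous f}.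
Proof. by move=> [U [_ Ux [cf _]]]; exact: cf. Qed.

Lemma smooth_atS M N (f : M -> N) x : smooth M N f -> smooth_at f x.
Proof. by move=> sf; exists setT; split=> //; exact: openT. Qed.

Lemma smooth_at_on M N (U : set M) (f : M -> N) :
  (forall x, U x -> smooth_at f x) -> smooth_on M N U f.
Proof.
move=> H; split=> [x /H /smooth_at_continuous//|phi psi Aphi Apsi k].
apply: Ck_local => y [py Uy fy]; have [V [oV Vy [cf sf]]] := H _ Uy.
exists [set y | [/\ ccod phi y, V (cinv phi y) & cdom psi (f (cinv phi y))]].
by split=> //; exact: sf.
Qed.

Lemma smooth_at_comp M N P (f : M -> N) (g : N -> P) x :
  smooth_at f x -> smooth_at g (f x) -> smooth_at (g \o f) x.
Proof.
move=> [U [oU Ux [cf sf]]] [V [oV Vx [cg sg]]].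
have oW : open (U `&` f @^-1` V) by exact: open_setI_preimage.
exists (U `&` f @^-1` V); split=> //; split=> [y [Uy Vy]|].
  by apply: continuous_comp; [exact: cf|exact: cg].
move=> phi psi Aphi Apsi k; apply: Ck_local => y0 [py0 [Uy0 Vy0] gfy0].
(* The middle chart depends on the point y0, since one chart need not contain the image of [f];
   [Ck_local] allows this. *)
pose chi := chart_at (f (cinv phi y0)).
pose O := U `&` f @^-1` (cdom chi `&` (V `&` g @^-1` cdom psi)).
exists [set y | ccod phi y /\ O (cinv phi y)]; split.
  by split=> //; split=> //; split=> //; exact: chart_at_cdom.
have oB : open [set y | ccod phi y /\ O (cinv phi y)].
  apply: open_chart_preimage; apply: open_setI_preimage => //.
  apply: openI; first exact: cdom_open.
  by apply: open_setI_preimage => //; exact: cdom_open.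
have sf' := sf _ _ Aphi (chart_at_atlas (f (cinv phi y0))) k.
have sg' := sg _ _ (chart_at_atlas (f (cinv phi y0))) Apsi k.
have E y : [set y | ccod phi y /\ O (cinv phi y)] y ->
    ((cto psi \o g \o cinv chi) \o (cto chi \o f \o cinv phi)) y =
    (cto psi \o (g \o f) \o cinv phi) y.
  by move=> [py [Uy [cy _]]] /=; rewrite ctoK.
apply: (Ck_ext oB E).
apply: (Ck_comp (has_frame_rV _) oB _ (Ck_sub _ sf') sg').
- move=> y [py [Uy [cy [Vy gy]]]] /=; rewrite ctoK//; split=> //.
  exact: cto_ccod.
- by move=> y [py [Uy [cy _]]].
Qed.

Lemma Ck_row_mx_same (V : normedModType R) m n k (A : set V)
    (f : V -> 'rV[R]_m) (g : V -> 'rV[R]_n) :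
  open A -> Ck k A f -> Ck k A g -> Ck k A (fun x => row_mx (f x) (g x)).
Proof.
move=> oA fk gk.
have ll : linear (fun u : 'rV[R]_m => row_mx u (0 : 'rV[R]_n)).
  by move=> a u v; rewrite scale_row_mx add_row_mx scaler0 addr0.
have lr : linear (fun u : 'rV[R]_n => row_mx (0 : 'rV[R]_m) u).
  by move=> a u v; rewrite scale_row_mx add_row_mx scaler0 addr0.
pose l : {linear 'rV[R]_m -> 'rV[R]_(m + n)} :=
  HB.pack (fun u : 'rV[R]_m => row_mx u (0 : 'rV[R]_n))
    (GRing.isLinear.Build _ _ _ _ _ ll).
pose r : {linear 'rV[R]_n -> 'rV[R]_(m + n)} :=
  HB.pack (fun u : 'rV[R]_n => row_mx (0 : 'rV[R]_m) u)
    (GRing.isLinear.Build _ _ _ _ _ lr).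
have cl : continuous l.
  move=> u; apply: (@continuous_comp _ _ _
    (fun u : 'rV[R]_m => (u, 0 : 'rV[R]_n)) (@row_mxp R m n)).
    have c0 : (0 : 'rV[R]_n) @[_ --> u] --> (0 : 'rV[R]_n) by exact: cst_continuous.
    exact: (cvg_pair cvg_id c0).
  exact: row_mxp_continuous.
have cr : continuous r.
  move=> u; apply: (@continuous_comp _ _ _
    (fun u : 'rV[R]_n => (0 : 'rV[R]_m, u)) (@row_mxp R m n)).
    have c0 : (0 : 'rV[R]_m) @[_ --> u] --> (0 : 'rV[R]_m) by exact: cst_continuous.
    exact: (cvg_pair c0 cvg_id).
  exact: row_mxp_continuous.
apply: Ck_ext oA _ (CkD oA (Ck_linear_comp oA cl fk) (Ck_linear_comp oA cr gk)).
by move=> x _ /=; rewrite add_row_mx addr0 add0r.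
Qed.

Lemma smooth_at_pair M N P (f : M -> N) (g : M -> P) x :
  smooth_at f x -> smooth_at g x ->
  @smooth_at M (prod_manifold N P) (fun y => (f y, g y)) x.
Proof.
move=> [U [oU Ux [cf sf]]] [V [oV Vx [cg sg]]].
exists (U `&` V); split=> //; first exact: openI.
split=> [y [Uy Vy]|]; first exact: (cvg_pair (cf y Uy) (cg y Vy)).
move=> phi _ Aphi [a [b [Aa Ab ->]]] k.
pose O := (U `&` f @^-1` cdom a) `&` (V `&` g @^-1` cdom b).
rewrite (_ : mkset _ = [set y | ccod phi y /\ O (cinv phi y)]); last first.
  by apply/seteqP; split=> y /= [] => [? [? ?] [? ?]|? [[? ?] [? ?]]].
apply: Ck_row_mx_same.
- apply: open_chart_preimage; apply: openI; apply: open_setI_preimage => //;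
  exact: cdom_open.
- by apply: Ck_sub (sf _ _ Aphi Aa k) => y [? [[? ?] _]].
- by apply: Ck_sub (sg _ _ Aphi Ab k) => y [? [_ [? ?]]].
Qed.

Lemma smooth_cst M N (c : N) : smooth M N (fun=> c).
Proof.
split=> [x _|phi psi _ _ k]; first exact: cvg_cst.
exact: Ck_cst.
Qed.

Lemma smooth_fst M N : smooth (prod_manifold M N) M fst.
Proof.
split=> [x _|_ psi [a [b [Aa Ab ->]]] Apsi k]; first exact: cvg_fst.
pose D := [set y | ccod a y /\ cdom psi (cinv a y)].
pose p : {linear 'rV[R]_(mdim M + mdim N) -> 'rV[R]_(mdim M)} := lsubmx.
have cp : continuous p by move=> y; exact: continuous_lsubmx.
have oA : open (p @^-1` D).
  by apply: open_comp => [y _|]; [exact: cp|exact/open_chart_preimage/cdom_open].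
have pD y : (p @^-1` D) y -> D (p y) by [].
have := Ck_comp (has_frame_rV _) oA pD (Ck_linear k _ cp) (atlas_compat Aa Apsi k).
by apply: Ck_sub => y [[? _] _ ?].
Qed.

Lemma smooth_snd M N : smooth (prod_manifold M N) N snd.
Proof.
split=> [x _|_ psi [a [b [Aa Ab ->]]] Apsi k]; first exact: cvg_snd.
pose D := [set y | ccod b y /\ cdom psi (cinv b y)].
pose p : {linear 'rV[R]_(mdim M + mdim N) -> 'rV[R]_(mdim N)} := rsubmx.
have cp : continuous p by move=> y; exact: continuous_rsubmx.
have oA : open (p @^-1` D).
  by apply: open_comp => [y _|]; [exact: cp|exact/open_chart_preimage/cdom_open].
have pD y : (p @^-1` D) y -> D (p y) by [].
have := Ck_comp (has_frame_rV _) oA pD (Ck_linear k _ cp) (atlas_compat Ab Apsi k).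
by apply: Ck_sub => y [[_ ?] _ ?].
Qed.

Lemma differentiable_rep M N (f : M -> N) x phi psi : smooth_at f x ->
  @atlas R M phi -> @atlas R N psi -> cdom phi x -> cdom psi (f x) ->
  differentiable (cto psi \o f \o cinv phi) (cto phi x).
Proof.
move=> [U [oU Ux [cf sf]]] Aphi Apsi px fx.
have [+ _] := sf _ _ Aphi Apsi 1%N; apply; rewrite /= ctoK//.
by split=> //; exact: cto_ccod.
Qed.

(** Stated for general charts because [tdiff_tangent_inv] compares an arbitrary chart of the atlas
    with [chart_at]. *)
Lemma diff_rep_comp M N P (f : M -> N) (g : N -> P) x phi chi psi v :
  smooth_at f x -> smooth_at g (f x) ->
  @atlas R M phi -> @atlas R N chi -> @atlas R P psi ->
  cdom phi x -> cdom chi (f x) -> cdom psi (g (f x)) ->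
  'd (cto psi \o (g \o f) \o cinv phi) (cto phi x) v =
  'd (cto psi \o g \o cinv chi) (cto chi (f x))
    ('d (cto chi \o f \o cinv phi) (cto phi x) v).
Proof.
move=> sf sg Aphi Achi Apsi px fx gx.
have df := differentiable_rep sf Aphi Achi px fx.
have dg := differentiable_rep sg Achi Apsi fx gx.
have fxE : (cto chi \o f \o cinv phi) (cto phi x) = cto chi (f x).
  by rewrite /= ctoK.
rewrite -fxE in dg *.
have E : \forall y \near cto phi x,
    ((cto psi \o g \o cinv chi) \o (cto chi \o f \o cinv phi)) y =
    (cto psi \o (g \o f) \o cinv phi) y.
  have : \forall y \near x, cdom chi (f y).
    apply: (smooth_at_continuous sf); apply: open_nbhs_nbhs.
    by split=> //; exact: cdom_open.
  by move=> /(near_cinv px); apply: filterS => y [_ cy] /=; rewrite ctoK.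
have [_ ->] := differentiable_nearE E (differentiable_comp df dg).
by rewrite (diff_comp df dg).
Qed.

Lemma tdiff_comp M N P (f : M -> N) (g : N -> P) x v :
  smooth_at f x -> smooth_at g (f x) ->
  tdiff M P (g \o f) x v = tdiff N P g (f x) (tdiff M N f x v).
Proof.
by move=> sf sg; apply: diff_rep_comp sf sg _ _ _ _ _ _;
  (exact: chart_at_atlas || exact: chart_at_cdom).
Qed.

Lemma tdiff_near M N (f g : M -> N) x v : smooth_at f x ->
  (\forall y \near x, f y = g y) ->
  tdiff M N f x v = tdiff M N g x v :> 'rV[R]_(mdim N).
Proof.
move=> sf fg; have fgx : f x = g x by exact: nbhs_singleton fg.
have df := differentiable_rep sf (chart_at_atlas x) (chart_at_atlas (f x))
  (chart_at_cdom x) (chart_at_cdom (f x)).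
rewrite /tdiff -fgx.
have E : \forall y \near cto (chart_at x) x,
    (cto (chart_at (f x)) \o f \o cinv (chart_at x)) y =
    (cto (chart_at (f x)) \o g \o cinv (chart_at x)) y.
  by apply: filterS (near_cinv (chart_at_cdom x) fg) => y [_ /= ->].
have [_ dE] := differentiable_nearE E df.
exact: esym (congr1 (@^~ v) dE).
Qed.

Lemma tdiff_is_linear M N (f : M -> N) x : linear (tdiff M N f x).
Proof. by move=> a u v; rewrite /tdiff linearP. Qed.

(** [tangent_inv] is the derivative of the identity read from [phi] to the preferred chart, so this
    is the chain rule for [f] after the identity. *)
Lemma tdiff_tangent_inv M N (f : M -> N) (phi : chart R M (mdim M)) y v :
  atlas phi -> ccod phi y -> smooth_at f (cinv phi y) ->
  tdiff M N f (cinv phi y) (tangent_inv M phi y v) =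
  'd (cto (chart_at (f (cinv phi y))) \o f \o cinv phi) y v.
Proof.
move=> Aphi py sf.
have yE : cto phi (cinv phi y) = y by rewrite cinvK.
have := @diff_rep_comp M M N id f (cinv phi y) phi (chart_at (cinv phi y))
  (chart_at (f (cinv phi y))) v (smooth_atS _ (smooth_id M)) sf Aphi
  (chart_at_atlas _) (chart_at_atlas _) (cinv_cdom py) (chart_at_cdom _)
  (chart_at_cdom _).
by rewrite yE => ->.
Qed.

End smooth_calculus.

(** * Group and differential calculus behind the gauge form *)

Section gauge.
Context {R : realType}.

(** For intermediate points that are only provably equal, such as gamma(x)^-1 gamma(x) and the
    unit. *)
Lemma tdiff_comp_eq (M N P : manifold R) (f : M -> N) (g : N -> P) x y v :
  f x = y -> smooth_at f x -> smooth_at g y ->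
  tdiff M P (g \o f) x v = tdiff N P g y (tdiff M N f x v)
    :> 'rV[R]_(mdim P).
Proof. by move=> <-; exact: tdiff_comp. Qed.

Lemma smooth_at_snd (M N P : manifold R) (f : M -> prod_manifold N P) x :
  smooth_at f x -> @smooth_at R M P (fun y => (f y).2) x.
Proof.
move=> sf; apply: (@smooth_at_comp R M (prod_manifold N P) P f snd) => //.
exact/smooth_atS/smooth_snd.
Qed.

Lemma diff_row_mxr m n (u : 'rV[R]_m) (y : 'rV[R]_n) :
  differentiable (fun y' => row_mx u y') y /\
  forall v, 'd (fun y' : 'rV[R]_n => row_mx u y') y v = row_mx 0 v.
Proof.
have dc : differentiable (cst u) y by exact: differentiable_cst.
have di : differentiable (id : 'rV[R]_n -> 'rV[R]_n) y.
  by apply: (@linear_differentiable _ _ _ idfun) => ?; exact: cvg_id.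
have dp : differentiable (fun y' => (cst u y', id y')) y.
  exact: differentiable_pair.
have dr := @differentiable_row_mxp R m n (cst u y, id y).
have rE : (fun y' => row_mx u y') = @row_mxp R m n \o (fun y' => (cst u y', id y')) by [].
split; first by rewrite rE; exact: differentiable_comp.
move=> v; rewrite rE (diff_comp dp dr).
rewrite (diff_lin _ (@row_mxp_continuous R m n)) /= (diff_pair dc di).
rewrite diff_cst.
have -> : 'd id y = id :> ('rV[R]_n -> 'rV[R]_n).
  by apply: (@diff_lin _ _ _ idfun) => ?; exact: cvg_id.
by [].
Qed.

Variable G : lie_group R.

Lemma ginv_unique (x y : G) : gmul x y = gone G -> y = ginv x.
Proof. by move=> xy; rewrite -[RHS]gmulg1 -xy gmulA gmulVg gmul1g. Qed.

Lemma ginvM (x y : G) : ginv (gmul x y) = gmul (ginv y) (ginv x).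
Proof.
apply/esym/ginv_unique; rewrite gmulA -(gmulA x y) gmulgV gmulg1.
exact: gmulgV.
Qed.

Lemma gmulVK (x y : G) : gmul (ginv x) (gmul x y) = y.
Proof. by rewrite gmulA gmulVg gmul1g. Qed.

Lemma gmulKV (x y : G) : gmul x (gmul (ginv x) y) = y.
Proof. by rewrite gmulA gmulgV gmul1g. Qed.

Lemma smooth_at_gmul (M : manifold R) (f g : M -> G) x :
  smooth_at f x -> smooth_at g x -> @smooth_at R M G (fun y => gmul (f y) (g y)) x.
Proof.
move=> sf sg.
apply: (@smooth_at_comp R M (prod_manifold G G) G (fun y => (f y, g y))
  (fun p => gmul p.1 p.2)); first exact: smooth_at_pair.
exact/smooth_atS/gmul_smooth.
Qed.

Lemma smooth_at_ginv (M : manifold R) (f : M -> G) x :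
  smooth_at f x -> @smooth_at R M G (fun y => ginv (f y)) x.
Proof.
move=> sf; apply: (@smooth_at_comp R M G G f (@ginv R G)) => //.
exact/smooth_atS/ginv_smooth.
Qed.

Lemma smooth_at_act (M E : manifold R) (act : E -> G -> E)
    (f : M -> E) (g : M -> G) x : right_lie_action act ->
  smooth_at f x -> smooth_at g x -> @smooth_at R M E (fun y => act (f y) (g y)) x.
Proof.
move=> ra sf sg.
apply: (@smooth_at_comp R M (prod_manifold E G) E (fun y => (f y, g y))
  (fun p => act p.1 p.2)); first exact: smooth_at_pair.
exact/smooth_atS/act_smooth.
Qed.

(** The form below is a partial derivative in the second variable along the diagonal, taken in a
    moving direction. As in the chain rule, that direction is expanded in a frame; one order of
    differentiability is spent on the derivative. *)
Lemma Ck_diff_diag (V : normedModType R) n k (O : set 'rV[R]_(n + n))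
    (A : set 'rV[R]_n) (f : 'rV[R]_(n + n) -> V) :
  open A -> (forall y, A y -> O (row_mx y y)) -> Ck k.+1 O f ->
  Ck k [set p : 'rV[R]_n * 'rV[R]_n | A p.1]
    (fun p => 'd f (row_mx p.1 p.1) (row_mx 0 p.2)).
Proof.
move=> oA AO [_ df].
have oA1 : open [set p : 'rV[R]_n * 'rV[R]_n | A p.1].
  exact: (@open_comp _ _ fst _ (fun x _ => cvg_fst) oA).
have [d [e [l [cl lE]]]] := @has_frame_rV R n.
pose D (p : 'rV[R]_n * 'rV[R]_n) : 'rV[R]_(n + n) := row_mx p.1 p.1.
pose p1 : {linear ('rV[R]_n * 'rV[R]_n)%type -> 'rV[R]_n} := fst.
pose p2 : {linear ('rV[R]_n * 'rV[R]_n)%type -> 'rV[R]_n} := snd.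
have c1 : continuous p1 by move=> p; exact: cvg_fst.
have c2 : continuous p2 by move=> p; exact: cvg_snd.
have CD : Ck k [set p | A p.1] D.
  by apply: Ck_row_mx_same => //; exact: (Ck_linear _ _ c1).
have H j : Ck k [set p | A p.1]
    (fun p => l j (p2 p) *: 'd f (D p) (row_mx 0 (e j))).
  apply: CkZ => //.
    exact: (Ck_linear_comp oA1 (cl j) (Ck_linear _ _ c2)).
  exact: (Ck_comp (has_frame_rV _) oA1 (fun p Ap => AO _ Ap) CD (df _)).
apply: Ck_ext oA1 _ (Ck_sum (index_enum _) oA1 H) => p Ap.
have -> : row_mx 0 p.2 = \sum_j l j p.2 *: row_mx 0 (e j) :> 'rV[R]_(n + n).
  rewrite [in LHS](lE p.2); elim/big_rec2: _ => [|j u w _ <-].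
    by rewrite row_mx0.
  by rewrite scale_row_mx add_row_mx scaler0 addr0.
by rewrite linear_sum/=; apply: eq_bigr => j _; rewrite linearZ.
Qed.

End gauge.

(** * Weighted connection forms *)

Section weighted_forms.
Context {R : realType}.
Variables (G : lie_group R) (E X : manifold R).
Variables (proj : E -> X) (act : E -> G -> E).

(* The affine analogue of [connection_form] over [W]: on vertical vectors the
   form is [f] times the Maurer-Cartan form. Weights make cut-off connection
   forms and their locally finite sums forms of the same kind. *)
Record weighted_form (W : set X) (f : X -> R)
    (omega : forall x : E, tangent E x -> lie_algebra G) : Prop := WeightedForm {
  wf_linear : forall x, W (proj x) -> linear (omega x);
  wf_smooth : forall phi, @atlas R E phi ->
    Cinf [set p : 'rV[R]_(mdim E) * 'rV[R]_(mdim E) |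
        ccod phi p.1 /\ W (proj (cinv phi p.1))]
      (fun p => omega (cinv phi p.1) (tangent_inv E phi p.1 p.2)
                  : 'rV[R]_(mdim G));
  wf_equivariant : forall x g (v : tangent E x), W (proj x) ->
    omega (act x g) (tdiff E E (fun y => act y g) x v) = ad_inv g (omega x v);
  wf_vertical : forall x (B : lie_algebra G), W (proj x) ->
    omega x (tdiff G E (act x) (gone G) B) = f (proj x) *: B }.

(** The derivative lives at gamma(x)^-1 gamma(x), which is only provably the unit; it counts as an
    element of the Lie algebra since the type of tangent vectors ignores the point. *)
Definition gauge_form (gamma : E -> G) (x : E) (v : tangent E x) :
    lie_algebra G :=
  tdiff E G (fun y => gmul (ginv (gamma x)) (gamma y)) x v.

Hypothesis act_action : right_lie_action act.
Hypothesis proj_smooth : smooth E X proj.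
Hypothesis proj_act : forall x g, proj (act x g) = proj x.

Variables (W : set X) (gamma : E -> G).
Hypothesis W_open : open W.
Hypothesis gamma_smooth : forall x, W (proj x) -> smooth_at gamma x.
Hypothesis gamma_act : forall x g, W (proj x) ->
  gamma (act x g) = gmul (gamma x) g.

Lemma near_proj x : W (proj x) -> \forall y \near x, W (proj y).
Proof.
move=> Wx; apply: (smooth_at_continuous (smooth_atS x proj_smooth)).
exact: open_nbhs_nbhs.
Qed.

Lemma smooth_at_translate c x : W (proj x) ->
  smooth_at (fun y => gmul c (gamma y)) x.
Proof.
move=> Wx; apply: smooth_at_gmul; last exact: gamma_smooth.
exact/smooth_atS/smooth_cst.
Qed.

Lemma gauge_form_smooth phi : @atlas R E phi ->
  Cinf [set p : 'rV[R]_(mdim E) * 'rV[R]_(mdim E) |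
      ccod phi p.1 /\ W (proj (cinv phi p.1))]
    (fun p => gauge_form gamma (tangent_inv E phi p.1 p.2) : 'rV[R]_(mdim G)).
Proof.
move=> Aphi k.
pose m (p : prod_manifold E E) : G := gmul (ginv (gamma p.1)) (gamma p.2).
pose S : set (prod_manifold E E) := [set p | W (proj p.1) /\ W (proj p.2)].
have sm : smooth_on (prod_manifold E E) G S m.
  apply: smooth_at_on => p [W1 W2]; apply: smooth_at_gmul.
    apply: smooth_at_ginv.
    apply: (@smooth_at_comp R (prod_manifold E E) E G fst gamma).
      exact/smooth_atS/smooth_fst.
    exact: gamma_smooth.
  apply: (@smooth_at_comp R (prod_manifold E E) E G snd gamma).
    exact/smooth_atS/smooth_snd.
  exact: gamma_smooth.
pose e := chart_at (gone G).
have Aphi2 : @atlas R (prod_manifold E E) (prod_chart phi phi).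
  by exists phi, phi.
pose mm := cto e \o m \o cinv (prod_chart phi phi).
pose A := [set y | ccod phi y /\ W (proj (cinv phi y))].
have oA : open A.
  apply: (open_chart_preimage (O := proj @^-1` W)).
  exact: (open_comp
    (fun x _ => smooth_at_continuous (smooth_atS x proj_smooth)) W_open).
have AO y : A y -> [set y | [/\ ccod (prod_chart phi phi) y,
    S (cinv (prod_chart phi phi) y) &
    cdom e (m (cinv (prod_chart phi phi) y))]] (row_mx y y).
  move=> [py Wy]; rewrite /= row_mxKl row_mxKr; split=> //.
  by rewrite /m gmulVg; exact: chart_at_cdom.
have oA1 : open [set p : 'rV[R]_(mdim E) * 'rV[R]_(mdim E) | A p.1].
  exact: (@open_comp _ _ fst _ (fun x _ => cvg_fst) oA).
have := Ck_diff_diag oA AO (sm.2 _ _ Aphi2 (chart_at_atlas _) k.+1).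
apply: Ck_ext oA1 _ => -[y v] [/= py Wy].
have Fx : gmul (ginv (gamma (cinv phi y))) (gamma (cinv phi y)) = gone G.
  exact: gmulVg.
rewrite /gauge_form tdiff_tangent_inv//; last exact: smooth_at_translate.
rewrite Fx -/e.
pose r (y' : 'rV[R]_(mdim E)) : 'rV[R]_(mdim E + mdim E) := row_mx y y'.
have -> : cto e \o (fun y' => gmul (ginv (gamma (cinv phi y))) (gamma y')) \o
    cinv phi = mm \o r.
  by apply/funext => y'; rewrite /mm /m /r /= row_mxKl row_mxKr.
have dmm : differentiable mm (r y).
  have [+ _] := sm.2 _ _ Aphi2 (chart_at_atlas (gone G)) 1%N.
  by apply; apply: AO.
have [dr drE] := diff_row_mxr y y.
by rewrite (diff_comp dr dmm) /= drE.
Qed.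

(** Equivariance differentiates gamma(xg)^-1 gamma(yg) = g^-1 gamma(x)^-1 gamma(y) g in y; the
    vertical condition differentiates gamma(x)^-1 gamma(xg) = g in g. *)
Lemma gauge_form_weighted : weighted_form W (fun=> 1) (gauge_form gamma).
Proof.
split.
- move=> x _ a u v.
  exact: (@tdiff_is_linear R E G (fun y => gmul (ginv (gamma x)) (gamma y)) x a u v).
- exact: gauge_form_smooth.
- move=> x g v Wx.
  have Wxg : W (proj (act x g)) by rewrite proj_act.
  have sa : smooth_at (fun y => act y g) x.
    apply: smooth_at_act => //; first exact/smooth_atS/smooth_id.
    exact/smooth_atS/smooth_cst.
  have sF := smooth_at_translate (ginv (gamma x)) Wx.
  have sF' := smooth_at_translate (ginv (gamma (act x g))) Wxg.
  pose C (a : G) := gmul (gmul (ginv g) a) g.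
  have sC : smooth_at C (gone G).
    apply: smooth_at_gmul; last exact/smooth_atS/smooth_cst.
    apply: smooth_at_gmul; first exact/smooth_atS/smooth_cst.
    exact/smooth_atS/smooth_id.
  rewrite /gauge_form /ad_inv -(tdiff_comp v sa sF').
  rewrite -[RHS](tdiff_comp_eq v (gmulVg _) sF sC).
  apply: tdiff_near; first exact: smooth_at_comp sF'.
  apply: filterS (near_proj Wx) => y Wy /=.
  by rewrite /C gamma_act// gamma_act// ginvM !gmulA.
- move=> x B Wx; rewrite scale1r /gauge_form.
  have sa : smooth_at (act x) (gone G).
    apply: (@smooth_at_act R G _ _ act (fun=> x) id) => //.
      exact/smooth_atS/smooth_cst.
    exact/smooth_atS/smooth_id.
  rewrite -(tdiff_comp_eq B (act1 act_action x) sa (smooth_at_translate _ Wx)).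
  have -> : (fun y => gmul (ginv (gamma x)) (gamma y)) \o act x = id.
    by apply/funext => g /=; rewrite gamma_act// gmulVK.
  exact: tdiff_id.
Qed.

End weighted_forms.

Section weighted_form_operations.
Context {R : realType}.

Lemma tdiffD (M N : manifold R) (f : M -> N) x (u v : tangent M x) :
  tdiff M N f x (u + v) = tdiff M N f x u + tdiff M N f x v.
Proof. by rewrite /tdiff linearD. Qed.

Lemma tdiffZ (M N : manifold R) (f : M -> N) x a (v : tangent M x) :
  tdiff M N f x (a *: v) = a *: tdiff M N f x v.
Proof. by rewrite /tdiff linearZ. Qed.

Lemma tdiff0 (M N : manifold R) (f : M -> N) x : tdiff M N f x 0 = 0.
Proof. by rewrite /tdiff linear0. Qed.

Definition smooth_scalar (X : manifold R) (f : X -> R) : Prop :=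
  forall phi, @atlas R X phi -> Cinf (ccod phi) (f \o cinv phi).

Lemma smooth_scalar_comp (E X : manifold R) (p : E -> X) (f : X -> R) :
  smooth E X p -> smooth_scalar f -> smooth_scalar (f \o p).
Proof.
move=> [cp sp] sf phi Aphi k; apply: Ck_local => y0 py0.
pose chi := chart_at (p (cinv phi y0)).
have Achi : atlas chi by exact: chart_at_atlas.
pose B := [set y | ccod phi y /\ (p @^-1` cdom chi) (cinv phi y)].
have oB : open B.
  apply: open_chart_preimage; apply: open_comp => [x _|]; first exact: cp.
  exact: cdom_open.
exists B; split; first by split=> //; exact: chart_at_cdom.
have sp' : Ck k B (cto chi \o p \o cinv phi).
  by apply: Ck_sub (sp _ _ Aphi Achi k) => y [? ?].
have E' y : B y ->
    ((f \o cinv chi) \o (cto chi \o p \o cinv phi)) y = ((f \o p) \o cinv phi) y.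
  by move=> [py cy] /=; rewrite ctoK.
have BC y : B y -> ccod chi ((cto chi \o p \o cinv phi) y).
  by move=> [py cy]; exact: cto_ccod.
exact: Ck_ext oB E' (Ck_comp (has_frame_rV _) oB BC sp' (sf _ Achi k)).
Qed.

Variables (G : lie_group R) (E X : manifold R).
Variables (proj : E -> X) (act : E -> G -> E).
Hypothesis proj_smooth : smooth E X proj.
Hypothesis proj_act : forall x g, proj (act x g) = proj x.
Implicit Types (W : set X) (f : X -> R).
Implicit Types omega : forall x : E, tangent E x -> lie_algebra G.

Lemma open_chart2 W phi : open W ->
  open [set p : 'rV[R]_(mdim E) * 'rV[R]_(mdim E) |
    ccod phi p.1 /\ W (proj (cinv phi p.1))].
Proof.
move=> oW; have oA : open [set y | ccod phi y /\ W (proj (cinv phi y))].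
  apply: (open_chart_preimage (O := proj @^-1` W)).
  exact: (open_comp
    (fun x _ => smooth_at_continuous (smooth_atS x proj_smooth)) oW).
exact: (@open_comp _ _ fst _ (fun x _ => cvg_fst) oA).
Qed.

Lemma weighted_form_local W f omega :
  (forall b, W b -> exists V, V b /\ weighted_form proj act V f omega) ->
  weighted_form proj act W f omega.
Proof.
move=> H; split.
- by move=> x /H[V [Vx wV]]; exact: (wf_linear wV).
- move=> phi Aphi k; apply: Ck_local => p [pp /H[V [Vx wV]]].
  exists [set p | ccod phi p.1 /\ V (proj (cinv phi p.1))]; split=> //.
  exact: (wf_smooth wV).
- by move=> x g v /H[V [Vx wV]]; exact: (wf_equivariant wV).
- by move=> x B /H[V [Vx wV]]; exact: (wf_vertical wV).
Qed.

Lemma weighted_form_ext W f f' omega omega' : open W ->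
  (forall b, W b -> f b = f' b) ->
  (forall x v, W (proj x) -> omega x v = omega' x v) ->
  weighted_form proj act W f omega -> weighted_form proj act W f' omega'.
Proof.
move=> oW ff oE w; split.
- by move=> x Wx a u v; rewrite -!oE//; exact: (wf_linear w).
- move=> phi Aphi k; have oA := open_chart2 (phi := phi) oW.
  have wk := wf_smooth w Aphi k.
  have oop p : [set p : 'rV[R]_(mdim E) * 'rV[R]_(mdim E) |
        ccod phi p.1 /\ W (proj (cinv phi p.1))] p ->
      omega (cinv phi p.1) (tangent_inv E phi p.1 p.2) =
      omega' (cinv phi p.1) (tangent_inv E phi p.1 p.2) :> 'rV[R]_(mdim G).
    by move=> [_ Wp]; exact: oE.
  exact: (Ck_ext oA oop wk).
- move=> x g v Wx; rewrite -!oE//; last by rewrite proj_act.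
  exact: (wf_equivariant w).
- by move=> x B Wx; rewrite -oE// -ff//; exact: (wf_vertical w).
Qed.

Lemma weighted_form0 W : weighted_form proj act W (fun=> 0) (fun _ _ => 0).
Proof.
split.
- by move=> x _ a u v; rewrite scaler0 addr0.
- by move=> phi Aphi k; exact: Ck_cst.
- by move=> x g v _; rewrite /ad_inv tdiff0.
- by move=> x B _; rewrite scale0r.
Qed.

Lemma weighted_formD W f f' omega omega' : open W ->
  weighted_form proj act W f omega -> weighted_form proj act W f' omega' ->
  weighted_form proj act W (f \+ f') (fun x v => omega x v + omega' x v).
Proof.
move=> oW w w'; split.
- move=> x Wx a u v; rewrite (wf_linear w Wx) (wf_linear w' Wx).
  by rewrite scalerDr addrACA.
- move=> phi Aphi k.
  exact: CkD (open_chart2 (phi := phi) oW) (wf_smooth w Aphi k) (wf_smooth w' Aphi k).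
- move=> x g v Wx; rewrite (wf_equivariant w)// (wf_equivariant w')//.
  by rewrite /ad_inv tdiffD.
- move=> x B Wx; rewrite (wf_vertical w)// (wf_vertical w')//.
  by rewrite scalerDl.
Qed.

Lemma weighted_formZ W (rho : X -> R) f omega : open W -> smooth_scalar rho ->
  weighted_form proj act W f omega ->
  weighted_form proj act W (fun b => rho b * f b)
    (fun x v => rho (proj x) *: omega x v).
Proof.
move=> oW srho w; split.
- move=> x Wx a u v; rewrite (wf_linear w Wx).
  by rewrite scalerDr !scalerA mulrC.
- move=> phi Aphi k; have oA := open_chart2 (phi := phi) oW.
  apply: (CkZ oA _ (wf_smooth w Aphi k)).
  pose p1 : {linear ('rV[R]_(mdim E) * 'rV[R]_(mdim E))%type -> 'rV[R]_(mdim E)} := fst.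
  have c1 : continuous p1 by move=> p; exact: cvg_fst.
  have AC p : [set p : 'rV[R]_(mdim E) * 'rV[R]_(mdim E) |
      ccod phi p.1 /\ W (proj (cinv phi p.1))] p -> ccod phi (p1 p).
    by case.
  exact: (Ck_comp (has_frame_rV _) oA AC (Ck_linear _ _ c1)
    (smooth_scalar_comp proj_smooth srho Aphi k)).
- move=> x g v Wx; rewrite (wf_equivariant w)// proj_act.
  by rewrite /ad_inv tdiffZ.
- by move=> x B Wx; rewrite (wf_vertical w)// scalerA.
Qed.

Lemma connection_form_weighted omega :
  weighted_form proj act setT (fun=> 1) omega -> connection_form act omega.
Proof.
move=> w; split.
- by move=> x; exact: (wf_linear w).
- move=> phi Aphi k; apply: Ck_sub (wf_smooth w Aphi k).
  by move=> p.
- by move=> x g v; exact: (wf_equivariant w).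
- by move=> x B; rewrite (wf_vertical w)// scale1r.
Qed.

End weighted_form_operations.

(** * Linearity of the composition in the Lie 2-algebra *)

Section tangent_composition.
Context {R : realType}.
Variables (G1 G0 : lie_group R) (G : lie_2group G1 G0).

Lemma ghom1 (H K : lie_group R) (f : H -> K) : ghom f -> f (gone H) = gone K.
Proof.
move=> hf; rewrite -(gmulVK (f (gone H)) (f (gone H))) -hf gmul1g.
exact: gmulVg.
Qed.

Lemma ghomV (H K : lie_group R) (f : H -> K) x : ghom f ->
  f (ginv x) = ginv (f x).
Proof. by move=> hf; apply: ginv_unique; rewrite -hf gmulgV ghom1. Qed.

Definition tangent_comp1 (v w z : lie_algebra G1) : Prop :=
  @tangent_comp R G1 G0 G (gone G1) v (gone G1) w (gone G1) z.

Lemma composableP (X1 X0 : manifold R) (X : lie_groupoid X1 X0) (a b : X1) :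
  src X a = tgt X b -> exists c : composable X, comp_fst c = a /\ comp_snd c = b.
Proof.
have [_ _ _ U _] := composable_fibre_product X.
by move=> /U[c [[ca cb] _]]; exists c.
Qed.

Lemma composable_inj (X1 X0 : manifold R) (X : lie_groupoid X1 X0)
    (c d : composable X) :
  comp_fst c = comp_fst d -> comp_snd c = comp_snd d -> c = d.
Proof.
have [_ _ C U _] := composable_fibre_product X.
move=> cd1 cd2; have [e [_ eU]] := U _ _ (C c).
by rewrite -(eU c)// -(eU d).
Qed.

Lemma tangent_comp10 : tangent_comp1 0 0 0.
Proof.
have s1 := ghom1 (src_hom G); have t1 := ghom1 (tgt_hom G).
have [|c [c1 c2]] := @composableP _ _ G (gone G1) (gone G1); first by rewrite s1 t1.
exists c, 0; split; last by split; exact: tdiff0.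
split=> //; rewrite comp_unitl//.
by rewrite c1 c2 t1 (ghom1 (unit_hom G)).
Qed.

(** Both witnesses lie over the pair of units, and a point of [composable G] is determined by its
    components; so the two tangent vectors sit at the same point and can be added. *)
Lemma tangent_comp1D v w z v' w' z' : tangent_comp1 v w z ->
  tangent_comp1 v' w' z' -> tangent_comp1 (v + v') (w + w') (z + z').
Proof.
move=> [c [xi [[c1 c2 c3] [<- <- <-]]]] [d [xi' [[d1 d2 d3] [<- <- <-]]]].
have dc : d = c by apply: composable_inj; rewrite ?c1 ?c2.
subst d; exists c, (xi + xi'); split; first by [].
by split; exact: tdiffD.
Qed.

Lemma tangent_comp1Z a v w z : tangent_comp1 v w z ->
  tangent_comp1 (a *: v) (a *: w) (a *: z).
Proof.
move=> [c [xi [cE [<- <- <-]]]]; exists c, (a *: xi); split; first by [].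
by split; exact: tdiffZ.
Qed.

End tangent_composition.

(** * Weighted connections on the 2-bundle *)

Section weighted_connections.
Context {R : realType}.
Variables (G1 G0 : lie_group R) (G : lie_2group G1 G0).
Variables (X E1 E0 : manifold R) (E : lie_groupoid E1 E0).
Variable P : principal_2bundle G (discrete_groupoid X) E.
Implicit Types (W : set X) (f : X -> R).
Implicit Types (eta : forall a : E1, tangent E1 a -> lie_algebra G1)
  (theta : forall x : E0, tangent E0 x -> lie_algebra G0).

Let pi1 : E1 -> X := bundle_proj1 P.
Let pi0 : E0 -> X := bundle_proj0 P.

Lemma proj_src a : pi0 (src E a) = pi1 a.
Proof. by have := gm_src (p2b_proj P) a; rewrite /pi0 /pi1 => <-. Qed.

Lemma proj_tgt a : pi0 (tgt E a) = pi1 a.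
Proof. by have := gm_tgt (p2b_proj P) a; rewrite /pi0 /pi1 => <-. Qed.

Lemma proj_unit x : pi1 (unit_arr E x) = pi0 x.
Proof. exact: (gm_unit (p2b_proj P)). Qed.

Lemma proj_comp_snd (c : composable E) : pi1 (comp_snd c) = pi1 (comp_fst c).
Proof.
have [_ _ C _ _] := composable_fibre_product E.
by rewrite -proj_tgt -proj_src C.
Qed.

Lemma proj_comp_arr (c : composable E) : pi1 (comp_arr c) = pi1 (comp_fst c).
Proof. by rewrite -proj_tgt tgt_comp proj_tgt. Qed.

Lemma proj1_smooth : smooth E1 X pi1.
Proof. exact: gm_smooth1 (p2b_proj P). Qed.

Lemma proj0_smooth : smooth E0 X pi0.
Proof. exact: gm_smooth0 (p2b_proj P). Qed.

Lemma proj1_act a g : pi1 (action1 P a g) = pi1 a.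
Proof. exact: (pb_fibre (p2b_principal1 P)). Qed.

Lemma proj0_act x g : pi0 (action0 P x g) = pi0 x.
Proof. exact: (pb_fibre (p2b_principal0 P)). Qed.

(** The composition clause ranges over tangent vectors of [composable E], not over triples as
    [sc_comp] does, so no equations between base points are carried along. *)
Record weighted_connection W f eta theta : Prop := WeightedConnection {
  wc_form1 : weighted_form pi1 (action1 P) W f eta;
  wc_form0 : weighted_form pi0 (action0 P) W f theta;
  wc_src : forall a (v : tangent E1 a), W (pi1 a) ->
    tdiff G1 G0 (src G) (gone G1) (eta a v) =
    theta (src E a) (tdiff E1 E0 (src E) a v);
  wc_tgt : forall a (v : tangent E1 a), W (pi1 a) ->
    tdiff G1 G0 (tgt G) (gone G1) (eta a v) =
    theta (tgt E a) (tdiff E1 E0 (tgt E) a v);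
  wc_unit : forall x (v : tangent E0 x), W (pi0 x) ->
    eta (unit_arr E x) (tdiff E0 E1 (unit_arr E) x v) =
    tdiff G0 G1 (unit_arr G) (gone G0) (theta x v);
  wc_comp : forall (c : composable E) (xi : tangent (composable E) c),
    W (pi1 (comp_fst c)) ->
    tangent_comp1 G
      (eta (comp_fst c) (tdiff (composable E) E1 (@comp_fst _ _ _ E) c xi))
      (eta (comp_snd c) (tdiff (composable E) E1 (@comp_snd _ _ _ E) c xi))
      (eta (comp_arr c) (tdiff (composable E) E1 (@comp_arr _ _ _ E) c xi)) }.

Lemma weighted_connection_local W f eta theta :
  (forall b, W b -> exists V, V b /\ weighted_connection V f eta theta) ->
  weighted_connection W f eta theta.
Proof.
move=> H; split.
- apply: weighted_form_local => b /H[V [Vb wV]]; exists V; split=> //.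
  exact: wc_form1 wV.
- apply: weighted_form_local => b /H[V [Vb wV]]; exists V; split=> //.
  exact: wc_form0 wV.
- by move=> a v /H[V [Vb wV]]; exact: (wc_src wV).
- by move=> a v /H[V [Vb wV]]; exact: (wc_tgt wV).
- by move=> x v /H[V [Vb wV]]; exact: (wc_unit wV).
- by move=> c xi /H[V [Vb wV]]; exact: (wc_comp wV).
Qed.

Lemma weighted_connection_ext W f f' eta eta' theta theta' : open W ->
  (forall b, W b -> f b = f' b) ->
  (forall a v, W (pi1 a) -> eta a v = eta' a v) ->
  (forall x v, W (pi0 x) -> theta x v = theta' x v) ->
  weighted_connection W f eta theta ->
  weighted_connection W f' eta' theta'.
Proof.
move=> oW ff o1 o0 w; split.
- exact: (weighted_form_ext proj1_smooth proj1_act oW ff o1 (wc_form1 w)).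
- exact: (weighted_form_ext proj0_smooth proj0_act oW ff o0 (wc_form0 w)).
- move=> a v Wa; rewrite -o1// -o0; last by rewrite proj_src.
  exact: (wc_src w).
- move=> a v Wa; rewrite -o1// -o0; last by rewrite proj_tgt.
  exact: (wc_tgt w).
- move=> x v Wx; rewrite -o0// -o1; last by rewrite proj_unit.
  exact: (wc_unit w).
- move=> c xi Wc; rewrite -!o1 ?proj_comp_snd ?proj_comp_arr//.
  exact: (wc_comp w).
Qed.

Lemma weighted_connection0 W :
  weighted_connection W (fun=> 0) (fun _ _ => 0) (fun _ _ => 0).
Proof.
split; try (by move=> *; exact: tdiff0); try exact: weighted_form0.
- by move=> x v _; rewrite tdiff0.
- by move=> *; exact: tangent_comp10.
Qed.

Lemma weighted_connectionD W f f' eta theta eta' theta' : open W ->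
  weighted_connection W f eta theta ->
  weighted_connection W f' eta' theta' ->
  weighted_connection W (f \+ f') (fun a v => eta a v + eta' a v)
    (fun x v => theta x v + theta' x v).
Proof.
move=> oW w w'; split.
- exact: (weighted_formD proj1_smooth oW (wc_form1 w) (wc_form1 w')).
- exact: (weighted_formD proj0_smooth oW (wc_form0 w) (wc_form0 w')).
- by move=> a v Wa; rewrite tdiffD (wc_src w)// (wc_src w').
- by move=> a v Wa; rewrite tdiffD (wc_tgt w)// (wc_tgt w').
- by move=> x v Wx; rewrite tdiffD (wc_unit w)// (wc_unit w').
- move=> c xi Wc.
  by apply: tangent_comp1D; [exact: (wc_comp w)|exact: (wc_comp w')].
Qed.

Lemma weighted_connectionZ W (rho : X -> R) f eta theta : open W ->
  smooth_scalar rho -> weighted_connection W f eta theta ->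
  weighted_connection W (fun b => rho b * f b)
    (fun a v => rho (pi1 a) *: eta a v)
    (fun x v => rho (pi0 x) *: theta x v).
Proof.
move=> oW srho w; split.
- exact: (weighted_formZ proj1_smooth proj1_act oW srho (wc_form1 w)).
- exact: (weighted_formZ proj0_smooth proj0_act oW srho (wc_form0 w)).
- by move=> a v Wa; rewrite tdiffZ (wc_src w)// proj_src.
- by move=> a v Wa; rewrite tdiffZ (wc_tgt w)// proj_tgt.
- by move=> x v Wx; rewrite tdiffZ (wc_unit w)// proj_unit.
- move=> c xi Wc; rewrite proj_comp_snd proj_comp_arr.
  by apply: tangent_comp1Z; exact: (wc_comp w).
Qed.

Lemma strict_connection_weighted eta theta :
  weighted_connection setT (fun=> 1) eta theta ->
  strict_connection P eta theta.
Proof.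
move=> w; split.
- exact: connection_form_weighted (wc_form1 w).
- exact: connection_form_weighted (wc_form0 w).
- by move=> a v; exact: (wc_src w).
- by move=> a v; exact: (wc_tgt w).
- by move=> x v; exact: (wc_unit w).
- move=> a v b w' c z [d [xi [[da db dc] [<- <- <-]]]].
  by subst a b c; exact: (wc_comp w).
Qed.

End weighted_connections.

(** * Local connections *)

Section local_connections.
Context {R : realType}.
Variables (G1 G0 : lie_group R) (G : lie_2group G1 G0).
Variables (X E1 E0 : manifold R) (E : lie_groupoid E1 E0).
Variable P : principal_2bundle G (discrete_groupoid X) E.

Let pi1 : E1 -> X := bundle_proj1 P.
Let pi0 : E0 -> X := bundle_proj0 P.
Let act1 : E1 -> G1 -> E1 := action1 P.
Let act0 : E0 -> G0 -> E0 := action0 P.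

(* The arrow part of a retraction of G1 x G1 onto the arrows composable with
   a given arrow [p.2]: it fixes [p.1] as soon as src p.1 = tgt p.2. Thus smooth
   germs of pairs of composable arrows lift to [composable G], although
   [composable_fibre_product] only speaks of maps defined on a whole manifold. *)
Definition retract_arr (p : prod_manifold G1 G1) : G1 :=
  gmul (gmul p.1 (ginv (unit_arr G (src G p.1)))) (unit_arr G (tgt G p.2)).

Lemma src_retract_arr p : src G (retract_arr p) = tgt G p.2.
Proof.
rewrite /retract_arr !(src_hom G) (ghomV _ (src_hom G)) !src_unit gmulgV.
exact: gmul1g.
Qed.

Lemma retract_arr_id p : src G p.1 = tgt G p.2 -> retract_arr p = p.1.
Proof. by rewrite /retract_arr => ->; rewrite -gmulA gmulVg gmulg1. Qed.

Lemma smooth_retract_arr : smooth (prod_manifold G1 G1) G1 retract_arr.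
Proof.
have [ss _ _] := src_submersion G; have [st _ _] := tgt_submersion G.
have su := unit_smooth G.
pose GG := prod_manifold G1 G1.
have s1 (p : GG) : @smooth_at R GG G1 fst p by exact/smooth_atS/smooth_fst.
have s2 (p : GG) : @smooth_at R GG G1 snd p by exact/smooth_atS/smooth_snd.
have ssp (p : GG) := smooth_at_comp (s1 p) (smooth_atS _ ss).
have stp (p : GG) := smooth_at_comp (s2 p) (smooth_atS _ st).
apply: smooth_at_on => p _.
have us := smooth_at_comp (ssp p) (smooth_atS _ su).
have ut := smooth_at_comp (stp p) (smooth_atS _ su).
exact: (smooth_at_gmul (smooth_at_gmul (s1 p) (smooth_at_ginv us)) ut).
Qed.

Lemma composable_retraction :
  exists H : prod_manifold G1 G1 -> composable G,
    [/\ smooth (prod_manifold G1 G1) (composable G) H,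
        (forall p, comp_fst (H p) = retract_arr p) &
        (forall p, comp_snd (H p) = p.2)].
Proof.
have /choice[H HE] p : exists c : composable G,
    comp_fst c = retract_arr p /\ comp_snd c = p.2.
  exact/composableP/src_retract_arr.
have H1 p : comp_fst (H p) = retract_arr p by case: (HE p).
have H2 p : comp_snd (H p) = p.2 by case: (HE p).
exists H; split=> //.
have [_ _ _ _ UP] := composable_fibre_product G; apply: UP.
  by rewrite (_ : _ \o _ = retract_arr); [exact: smooth_retract_arr|apply/funext].
by rewrite (_ : _ \o _ = snd); [exact: smooth_snd|apply/funext].
Qed.

(* A gauge amounts to a trivialization of the 2-bundle over [U]. *)
Record gauge (U : set X) (gamma1 : E1 -> G1) (gamma0 : E0 -> G0) : Prop := Gauge {
  gauge_smooth1 : forall a, U (pi1 a) -> smooth_at gamma1 a;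
  gauge_smooth0 : forall x, U (pi0 x) -> smooth_at gamma0 x;
  gauge_act1 : forall a g, U (pi1 a) -> gamma1 (act1 a g) = gmul (gamma1 a) g;
  gauge_act0 : forall x g, U (pi0 x) -> gamma0 (act0 x g) = gmul (gamma0 x) g;
  gauge_src : forall a, U (pi1 a) -> src G (gamma1 a) = gamma0 (src E a);
  gauge_tgt : forall a, U (pi1 a) -> tgt G (gamma1 a) = gamma0 (tgt E a);
  gauge_unit : forall x, U (pi0 x) ->
    gamma1 (unit_arr E x) = unit_arr G (gamma0 x);
  gauge_comp : forall (c : composable E) (d : composable G),
    U (pi1 (comp_fst c)) -> comp_fst d = gamma1 (comp_fst c) ->
    comp_snd d = gamma1 (comp_snd c) -> gamma1 (comp_arr c) = comp_arr d }.

Section gauge_connection.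
Variables (U : set X) (gamma1 : E1 -> G1) (gamma0 : E0 -> G0).
Hypothesis U_open : open U.
Hypothesis gg : gauge U gamma1 gamma0.

Let near1 a : U (pi1 a) -> \forall y \near a, U (pi1 y).
Proof. exact: (near_proj (proj1_smooth P) U_open). Qed.

Let near0 x : U (pi0 x) -> \forall y \near x, U (pi0 y).
Proof. exact: (near_proj (proj0_smooth P) U_open). Qed.

Let translate1 c a : U (pi1 a) -> smooth_at (fun y => gmul c (gamma1 y)) a.
Proof. exact: (smooth_at_translate (gauge_smooth1 gg)). Qed.

Let translate0 c x : U (pi0 x) -> smooth_at (fun y => gmul c (gamma0 y)) x.
Proof. exact: (smooth_at_translate (gauge_smooth0 gg)). Qed.

(** One argument for source and target: a homomorphism s with s gamma1 = gamma0 t carries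
    gamma1(a)^-1 gamma1(y) to gamma0(t a)^-1 gamma0(t y), and this is differentiated at y = a. *)
Let gauge_hom (s : G1 -> G0) (t : E1 -> E0) a v : ghom s ->
  smooth G1 G0 s -> smooth E1 E0 t ->
  (forall a, pi0 (t a) = pi1 a) ->
  (forall a, U (pi1 a) -> s (gamma1 a) = gamma0 (t a)) -> U (pi1 a) ->
  tdiff G1 G0 s (gone G1) (gauge_form gamma1 v) =
  gauge_form gamma0 (tdiff E1 E0 t a v).
Proof.
move=> hs ss st tE sE Ua.
have Uta : U (pi0 (t a)) by rewrite tE.
have sF := translate1 (ginv (gamma1 a)) Ua.
have sF' := translate0 (ginv (gamma0 (t a))) Uta.
rewrite /gauge_form -(tdiff_comp v (smooth_atS a st) sF').
rewrite -[LHS](tdiff_comp_eq v (gmulVg _) sF (smooth_atS _ ss)).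
apply: tdiff_near; first exact: smooth_at_comp sF (smooth_atS _ ss).
by apply: filterS (near1 Ua) => y Uy /=; rewrite hs ghomV// !sE.
Qed.

(** The translates [alpha] and [beta] of gamma1 along the two factors are composable near c, with
    composite [kappa]. Lifting them to a map [h] into [composable G], the image of xi under the
    differential of [h] is the required tangent vector. *)
Let gauge_comp_form (c : composable E) (xi : tangent (composable E) c) :
  U (pi1 (comp_fst c)) ->
  tangent_comp1 G
    (gauge_form gamma1 (tdiff (composable E) E1 (@comp_fst _ _ _ E) c xi))
    (gauge_form gamma1 (tdiff (composable E) E1 (@comp_snd _ _ _ E) c xi))
    (gauge_form gamma1 (tdiff (composable E) E1 (@comp_arr _ _ _ E) c xi)).
Proof.
move=> U1.
have U2 : U (pi1 (comp_snd c)) by rewrite /pi1 proj_comp_snd.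
have U3 : U (pi1 (comp_arr c)) by rewrite /pi1 proj_comp_arr.
have [sf ss fib _ _] := composable_fibre_product E.
have [Gf Gs Gfib _ _] := composable_fibre_product G.
have sc := comp_smooth E.
have [H [sH H1 H2]] := composable_retraction.
pose alpha (y : composable E) := gmul (ginv (gamma1 (comp_fst c))) (gamma1 (comp_fst y)).
pose beta (y : composable E) := gmul (ginv (gamma1 (comp_snd c))) (gamma1 (comp_snd y)).
pose kappa (y : composable E) := gmul (ginv (gamma1 (comp_arr c))) (gamma1 (comp_arr y)).
have sa : @smooth_at R (composable E) G1 alpha c.
  exact: (smooth_at_comp (smooth_atS c sf) (translate1 _ U1)).
have sb : @smooth_at R (composable E) G1 beta c.
  exact: (smooth_at_comp (smooth_atS c ss) (translate1 _ U2)).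
(* [h] is defined everywhere but lifts (alpha, beta) only over [U], which is enough for derivatives
   at c. *)
pose h : composable E -> composable G := H \o (fun y => (alpha y, beta y)).
have sh : smooth_at h c.
  apply: (@smooth_at_comp R (composable E) (prod_manifold G1 G1) (composable G)
    (fun y => (alpha y, beta y)) H).
    exact: smooth_at_pair.
  exact: smooth_atS.
have nearU : \forall y \near c, U (pi1 (comp_fst y)).
  exact: (smooth_at_continuous (smooth_atS c sf)) (near1 U1).
have fstE y : U (pi1 (comp_fst y)) -> comp_fst (h y) = alpha y.
  move=> Uy; rewrite /h /= H1; apply: retract_arr_id => /=.
  have Uy2 : U (pi1 (comp_snd y)) by rewrite /pi1 proj_comp_snd.
  rewrite (src_hom G) (tgt_hom G) (ghomV _ (src_hom G)) (ghomV _ (tgt_hom G)).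
  by rewrite !(gauge_src gg)// !(gauge_tgt gg)// !fib.
have sndE y : comp_snd (h y) = beta y by rewrite /h /= H2.
have compE y : U (pi1 (comp_fst y)) -> comp_arr (h y) = kappa y.
  move=> Uy; rewrite /kappa.
  have Uy2 : U (pi1 (comp_snd y)) by rewrite /pi1 proj_comp_snd.
  have [r [r1 r2]] : exists r : composable G,
      comp_fst r = gamma1 (comp_fst c) /\ comp_snd r = gamma1 (comp_snd c).
    by apply: composableP; rewrite (gauge_src gg)// (gauge_tgt gg)// fib.
  have [s [s1 s2]] : exists s : composable G,
      comp_fst s = gamma1 (comp_fst y) /\ comp_snd s = gamma1 (comp_snd y).
    by apply: composableP; rewrite (gauge_src gg)// (gauge_tgt gg)// fib.
  (* Interchange law: s is the product of r and h(y) in both components, so the composite of s is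
     the product of their composites; cancelling that of r leaves [kappa y]. *)
  rewrite (gauge_comp gg U1 r1 r2) (gauge_comp gg Uy s1 s2).
  rewrite (@comp_hom _ _ _ G r (h y) s) ?gmulVK//.
    by rewrite s1 r1 fstE// gmulKV.
  by rewrite s2 r2 sndE gmulKV.
exists (h c), (tdiff (composable E) (composable G) h c xi).
split; split.
- by rewrite fstE// /alpha gmulVg.
- by rewrite sndE /beta gmulVg.
- by rewrite compE// /kappa gmulVg.
- rewrite /gauge_form -(tdiff_comp _ (smooth_atS c sf) (translate1 _ U1)).
  rewrite -(tdiff_comp xi sh (smooth_atS _ Gf)).
  apply: tdiff_near; first exact: smooth_at_comp sh (smooth_atS _ Gf).
  by apply: filterS nearU => y Uy /=; rewrite fstE.
- rewrite /gauge_form -(tdiff_comp _ (smooth_atS c ss) (translate1 _ U2)).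
  rewrite -(tdiff_comp xi sh (smooth_atS _ Gs)).
  apply: tdiff_near; first exact: smooth_at_comp sh (smooth_atS _ Gs).
  by apply: filterS nearU => y Uy /=; rewrite sndE.
- rewrite /gauge_form -(tdiff_comp _ (smooth_atS c sc) (translate1 _ U3)).
  rewrite -(tdiff_comp xi sh (smooth_atS _ (comp_smooth G))).
  apply: tdiff_near; first exact: smooth_at_comp sh (smooth_atS _ (comp_smooth G)).
  by apply: filterS nearU => y Uy /=; rewrite compE.
Qed.

Lemma gauge_connection :
  weighted_connection P U (fun=> 1) (gauge_form gamma1) (gauge_form gamma0).
Proof.
split.
- exact: (gauge_form_weighted (ga_action1 (p2b_action P)) (proj1_smooth P)
    (@proj1_act _ _ _ _ _ _ _ _ P) U_open (gauge_smooth1 gg) (gauge_act1 gg)).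
- exact: (gauge_form_weighted (ga_action0 (p2b_action P)) (proj0_smooth P)
    (@proj0_act _ _ _ _ _ _ _ _ P) U_open (gauge_smooth0 gg) (gauge_act0 gg)).
- move=> a v Ua; have [ss _ _] := src_submersion G; have [st _ _] := src_submersion E.
  exact: (gauge_hom v (src_hom G) ss st (@proj_src _ _ _ _ _ _ _ _ P) (gauge_src gg)).
- move=> a v Ua; have [ss _ _] := tgt_submersion G; have [st _ _] := tgt_submersion E.
  exact: (gauge_hom v (tgt_hom G) ss st (@proj_tgt _ _ _ _ _ _ _ _ P) (gauge_tgt gg)).
- move=> x v Ux; have su := unit_smooth E; have sg := unit_smooth G.
  have Uux : U (pi1 (unit_arr E x)) by rewrite /pi1 proj_unit.
  have sF := translate0 (ginv (gamma0 x)) Ux.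
  have sF' := translate1 (ginv (gamma1 (unit_arr E x))) Uux.
  rewrite /gauge_form -(tdiff_comp v (smooth_atS x su) sF').
  rewrite -[RHS](tdiff_comp_eq v (gmulVg _) sF (smooth_atS _ sg)).
  apply: tdiff_near; first exact: smooth_at_comp (smooth_atS x su) sF'.
  apply: filterS (near0 Ux) => y Uy /=.
  by rewrite (unit_hom G) (ghomV _ (unit_hom G)) !(gauge_unit gg).
- exact: gauge_comp_form.
Qed.

End gauge_connection.

End local_connections.

(** * Existence of local gauges *)

Section gauge_existence.
Context {R : realType}.
Variables (G1 G0 : lie_group R) (G : lie_2group G1 G0).
Variables (X E1 E0 : manifold R) (E : lie_groupoid E1 E0).
Variable P : principal_2bundle G (discrete_groupoid X) E.

Lemma smooth_on_at (M N : manifold R) (U : set M) (f : M -> N) x :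
  open U -> smooth_on M N U f -> U x -> smooth_at f x.
Proof. by move=> oU sf Ux; exists U. Qed.

Lemma open_proj (M : manifold R) (p : M -> X) (U : set X) :
  smooth M X p -> open U -> open (p @^-1` U).
Proof.
by move=> sp; apply: open_comp => x _; exact: (smooth_at_continuous (smooth_atS x sp)).
Qed.

(* A local section [s] of E0 and its unit arrows trivialize both levels in a
   compatible way. *)
Lemma gauge_exists (b : X) : exists (U : set X) gamma1 gamma0,
  [/\ open U, U b & gauge P U gamma1 gamma0].
Proof.
pose pi1 : E1 -> X := bundle_proj1 P; pose pi0 : E0 -> X := bundle_proj0 P.
pose act1 : E1 -> G1 -> E1 := action1 P; pose act0 : E0 -> G0 -> E0 := action0 P.
have [U0 [h0 [k0 [[oU0 U0b] sh0 sk0 hk0 kh0]]]] := pb_trivial (p2b_principal0 P) b.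
have [U1 [h1 [k1 [[oU1 U1b] sh1 sk1 hk1 kh1]]]] := pb_trivial (p2b_principal1 P) b.
have pu x : pi1 (unit_arr E x) = pi0 x := proj_unit P x.
pose s (y : X) : E0 := k0 (y, gone G0).
pose us (y : X) : E1 := unit_arr E (s y).
have ps y : U0 y -> pi0 (s y) = y by move=> U0y; have [] := kh0 (y, gone G0) U0y.
have hs y : U0 y -> h0 (s y) = (y, gone G0).
  by move=> U0y; have [] := kh0 (y, gone G0) U0y.
have pus y : U0 y -> pi1 (us y) = y by move=> U0y; rewrite pu ps.
pose U := U0 `&` U1.
pose gamma0 x : G0 := (h0 x).2.
(* The trivialization [h1] of E1 is unrelated to the units of [s]; the left factor renormalizes it
   so that gamma1 is 1 on [us]. For gamma0 this is automatic, as [s] is the unit section of [h0]. *)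
pose gamma1 a : G1 := gmul (ginv (h1 (us (pi1 a))).2) (h1 a).2.
have gamma0E y g : U y -> gamma0 (act0 (s y) g) = g.
  move=> [U0y U1y]; have [|_ _ hE] := hk0 (s y); first by rewrite [bundle_proj0 P _]ps.
  by rewrite /gamma0 hE hs// gmul1g.
have gamma1E y g : U y -> gamma1 (act1 (us y) g) = g.
  move=> [U0y U1y]; have [|_ _ hE] := hk1 (us y); first by rewrite [bundle_proj1 P _]pus.
  by rewrite /gamma1 /pi1 proj1_act [bundle_proj1 P _]pus// hE gmulVK.
have act0E x : U (pi0 x) -> x = act0 (s (pi0 x)) (gamma0 x).
  move=> [U0x _]; have [kx hx _] := hk0 x U0x.
  have [|ka _ hE] := hk0 (s (pi0 x)); first by rewrite [bundle_proj0 P _]ps.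
  have [|kb _ _] := hk0 (act0 (s (pi0 x)) (gamma0 x)).
    by rewrite proj0_act [bundle_proj0 P _]ps.
  have hxE : h0 x = (pi0 x, gamma0 x) by rewrite -[pi0 x]hx /gamma0; case: (h0 x).
  by rewrite -kb hE hs//= gmul1g -hxE kx.
have act1E a : U (pi1 a) -> a = act1 (us (pi1 a)) (gamma1 a).
  move=> [U0a U1a]; have [ka ha _] := hk1 a U1a.
  have [|_ hu hE] := hk1 (us (pi1 a)); first by rewrite [bundle_proj1 P _]pus.
  have [|kb _ _] := hk1 (act1 (us (pi1 a)) (gamma1 a)).
    by rewrite proj1_act [bundle_proj1 P _]pus.
  have haE : h1 a = (pi1 a, (h1 a).2) by rewrite -[pi1 a]ha; case: (h1 a).
  by rewrite -kb hE hu [bundle_proj1 P _]pus// /gamma1 gmulKV -haE ka.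
have ss y : U0 y -> smooth_at s y.
  move=> U0y; apply: (@smooth_at_comp R X (prod_manifold X G0) E0
    (fun y => (y, gone G0)) k0).
    apply: smooth_at_pair; first exact/smooth_atS/smooth_id.
    exact/smooth_atS/smooth_cst.
  apply: smooth_on_at sk0 _ => //.
  exact: (open_comp (fun x _ => smooth_at_continuous (smooth_atS x (smooth_fst X G0))) oU0).
have sus y : U0 y -> smooth_at us y.
  by move=> /ss sy; exact: (smooth_at_comp sy (smooth_atS _ (unit_smooth E))).
have sh0' x : U0 (pi0 x) -> smooth_at h0 x.
  by apply: smooth_on_at sh0; exact: open_proj (proj0_smooth P) oU0.
have sh1' a : U1 (pi1 a) -> smooth_at h1 a.
  by apply: smooth_on_at sh1; exact: open_proj (proj1_smooth P) oU1.
exists U, gamma1, gamma0; split; [exact: openI|by []|split].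
- move=> a [U0a U1a]; apply: smooth_at_gmul; last exact/smooth_at_snd/sh1'.
  apply: smooth_at_ginv; apply: smooth_at_snd.
  apply: (@smooth_at_comp R E1 E1 (prod_manifold X G1) (us \o pi1) h1).
    apply: (@smooth_at_comp R E1 X E1 pi1 us); last exact: sus.
    exact/smooth_atS/(proj1_smooth P).
  by apply: sh1'; rewrite /= pus.
- by move=> x [U0x _]; exact/smooth_at_snd/sh0'.
- move=> a g [U0a U1a]; have [_ _ hE] := hk1 a U1a.
  by rewrite /gamma1 /pi1 proj1_act hE gmulA.
- by move=> x g [U0x _]; have [_ _ hE] := hk0 x U0x; rewrite /gamma0 hE.
(* The source of us(y) g is s(y) src(g) because us(y) is a unit, and gamma0 reads off src(g). *)
- move=> a Ua; rewrite [in RHS](act1E a Ua) (ga_src (p2b_action P)) src_unit.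
  by rewrite gamma0E.
- move=> a Ua; rewrite [in RHS](act1E a Ua) (ga_tgt (p2b_action P)) tgt_unit.
  by rewrite gamma0E.
- move=> x Ux; rewrite [in LHS](act0E x Ux) -(ga_unit (p2b_action P)).
  exact: gamma1E.
(* A unit is idempotent: composing us(y) g with us(y) g' gives us(y) times the composite of g and
   g'. *)
- move=> c d Uc d1 d2; pose y := pi1 (comp_fst c).
  have [e [e1 e2]] : exists e : composable E, comp_fst e = us y /\ comp_snd e = us y.
    by apply: composableP; rewrite src_unit tgt_unit.
  have ee : comp_arr e = us y by rewrite comp_unitl// e1 e2 tgt_unit.
  have y2 : pi1 (comp_snd c) = y := proj_comp_snd P c.
  rewrite -(ga_comp (p2b_action P) (c := e) (d := c) (g := d)).
  + by rewrite ee gamma1E.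
  + by rewrite e1 d1 -[LHS]/(comp_fst c) [LHS](act1E _ Uc).
  + by rewrite e2 d2 [LHS]act1E y2.
Qed.

End gauge_existence.

(** * Gluing *)

Section cutoff.
Context {R : realType}.

(** The bump lives in a chart and is extended by zero. It vanishes outside [K], the image of a
    compact ball, which is closed because X is Hausdorff; so the complement of [K] is open, the
    extension is smooth there too, and it serves as [W]. *)
Lemma manifold_cutoff (X : manifold R) (b : X) (U : set X) : open U -> U b ->
  exists (rho : X -> R) (V W : set X),
    [/\ smooth_scalar rho,
        [/\ open V, V b & forall x, V x -> rho x = 1] &
        [/\ open W, (forall x, W x -> rho x = 0) & forall x, U x \/ W x]].
Proof.
move=> oU Ub; pose phi := chart_at b; pose y0 := cto phi b.
have Aphi : atlas phi := chart_at_atlas b.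
have pb : cdom phi b := chart_at_cdom b.
have : nbhs y0 [set y | ccod phi y /\ U (cinv phi y)].
  apply: open_nbhs_nbhs; split; first exact: open_chart_preimage.
  by split; [exact: cto_ccod|rewrite /y0 ctoK].
move=> /nbhs_ballP[e /= e0 eO].
(* Any r with 0 < 2 r < e keeps the closed ball [C] inside the chart and over [U]. *)
pose r := e / 4; have r0 : 0 < r by rewrite divr_gt0.
have r2e : 2 * r < e by rewrite /r; lra.
have [bump [Cb b1 b0]] := cutoff_exists y0 r0.
pose C := [set y : 'rV[R]_(mdim X) | `|y - y0| <= 2 * r].
have CO y : C y -> ccod phi y /\ U (cinv phi y).
  move=> Cy; apply: eO; rewrite -ball_normE /= distrC; exact: le_lt_trans r2e.
have cC : compact C.
  apply: bounded_closed_compact.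
    exists (2 * r + `|y0|); split; first exact: num_real.
    move=> M HM y Cy; rewrite /= -(subrK y0 y) (le_trans (ler_normD _ _))//.
    by rewrite (le_trans _ (ltW HM))// lerD2r.
  have -> : C = closed_ball_ Num.norm y0 (2 * r).
    by apply/seteqP; split=> y; rewrite /C /closed_ball_ /= distrC.
  exact: closed_closed_ball_.
pose K := cinv phi @` C.
have clK : closed K.
  apply: compact_closed; first exact: manifold_hausdorff.
  apply: continuous_compact cC.
  apply/continuous_in_subspaceT => y; rewrite inE => /CO[py _].
  exact: cinv_continuous.
have KU x : K x -> cdom phi x /\ U x.
  by move=> [y /CO[py Uy] <-]; split=> //; exact: cinv_cdom.
pose rho x := if `[< cdom phi x >] then bump (cto phi x) else 0.
have rhoE x : cdom phi x -> rho x = bump (cto phi x).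
  by move=> px; rewrite /rho asboolT.
have rho0 x : ~ K x -> rho x = 0.
  move=> nK; rewrite /rho; case: asboolP => // px; apply: b0.
  rewrite leNgt; apply/negP => /ltW Cx; apply: nK.
  by exists (cto phi x) => //; rewrite ctoK.
have oK : open (~` K) by exact: closed_openC.
exists rho, (cdom phi `&` cto phi @^-1` [set y | `|y - y0| < r]), (~` K).
split; [|split|split].
- move=> psi Apsi k; apply: Ck_local => y py.
  have [px|px] := pselect (cdom phi (cinv psi y)).
    pose B := [set y | ccod psi y /\ cdom phi (cinv psi y)].
    have oB : open B by exact/open_chart_preimage/cdom_open.
    exists B; split; first by split.
    have E z : B z -> (bump \o (cto phi \o cinv psi)) z = (rho \o cinv psi) z.
      by move=> [pz qz]; rewrite /= rhoE.
    exact: (Ck_ext oB E (Ck_comp (has_frame_rV _) oB (fun _ _ => I)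
      (atlas_compat Apsi Aphi k) (Cb k))).
  pose B := [set y | ccod psi y /\ (~` K) (cinv psi y)].
  exists B; split; first by split=> // /KU[].
  have E z : B z -> cst 0 z = (rho \o cinv psi) z.
    by move=> [_ Kz]; rewrite /= rho0.
  exact: (Ck_ext (open_chart_preimage (phi := psi) oK) E (Ck_cst _ _ _)).
- apply: open_setI_preimage; first exact: cdom_open.
    by move=> x px; exact: cto_continuous.
  have -> : [set y | `|y - y0| < r] = ball y0 r.
    by apply/seteqP; split=> y; rewrite -ball_normE /= distrC.
  exact: ball_open.
- by split=> //=; rewrite subrr normr0.
- by move=> x [px xr]; rewrite rhoE// b1.
- exact: oK.
- exact: rho0.
- by move=> x; have [/KU[_ Ux]|nK] := pselect (K x); [left|right].
Qed.

(** [f] numbers the countable basis, and [c n] picks some b such that V b contains the basis set of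
    number n, or [None] if there is no such b. Injectivity of [f] ensures that the set contained in
    the chosen V b is the one around x. *)
Lemma second_countable_lindelof (T : topologicalType) (V : T -> set T) :
  @second_countable T -> (forall x, nbhs x (V x)) ->
  exists c : nat -> option T, forall x, exists n b, c n = Some b /\ V b x.
Proof.
move=> [B /countable_injP[f finj] [oB bB]] HV.
pose Q n b := exists A, [/\ B A, f A = n & A `<=` V b].
pose c n := if pselect (exists b, Q n b) is left ex
  then Some (projT1 (cid ex)) else None.
exists c => x; have [A [BA Ax] AV] := bB x _ (HV x).
have ex : exists b, Q (f A) b by exists x, A.
exists (f A); rewrite /c; case: pselect => // ex'.
case: (cid ex') => b /= [A' [BA' fA' AV']]; exists b; split=> //.
by apply: AV'; rewrite (_ : A' = A)//; apply: finj; rewrite ?inE.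
Qed.

End cutoff.

Section gluing.
Context {R : realType}.

Section scalars.
Variable X : manifold R.

Lemma smooth_scalar_cst (c : R) : @smooth_scalar R X (fun=> c).
Proof. by move=> phi _ k; exact: Ck_cst. Qed.

Lemma smooth_scalarD (f g : X -> R) :
  smooth_scalar f -> smooth_scalar g -> smooth_scalar (fun x => f x + g x).
Proof.
move=> sf sg phi Aphi k.
exact: (@CkD R _ R k _ _ _ (@ccod_open _ _ _ phi) (sf phi Aphi k) (sg phi Aphi k)).
Qed.

Lemma smooth_scalarM (f g : X -> R) :
  smooth_scalar f -> smooth_scalar g -> smooth_scalar (fun x => f x * g x).
Proof.
move=> sf sg phi Aphi k.
exact: (@CkZ R _ R k _ _ _ (@ccod_open _ _ _ phi) (sf phi Aphi k) (sg phi Aphi k)).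
Qed.

(* For a sequence [rho] such that the interiors of [rho n = 1] cover [X], the
   functions [leftover rho n * rho n] form a locally finite partition of unity
   (of possibly negative functions). *)
Fixpoint leftover (rho : nat -> X -> R) (n : nat) (x : X) : R :=
  if n is n'.+1 then leftover rho n' x * (1 + (-1) * rho n' x) else 1.

Lemma smooth_leftover rho n : (forall i, smooth_scalar (rho i)) ->
  smooth_scalar (leftover rho n).
Proof.
move=> srho; elim: n => [|n IH]; first exact: smooth_scalar_cst.
apply: smooth_scalarM IH _; apply: smooth_scalarD; first exact: smooth_scalar_cst.
by apply: smooth_scalarM (srho n); exact: smooth_scalar_cst.
Qed.

Lemma leftover_eq0 rho n m x : rho n x = 1 -> (n < m)%N -> leftover rho m x = 0.
Proof.
move=> r1; elim: m => // m IH; rewrite ltnS leq_eqVlt => /predU1P[<-|/IH /= ->].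
  by rewrite /= r1 mulr1 subrr mulr0.
by rewrite mul0r.
Qed.

Lemma sum_leftover rho n x :
  \sum_(i < n) leftover rho i x * rho i x = 1 - leftover rho n x.
Proof.
elim: n => [|n IH]; first by rewrite big_ord0 subrr.
by rewrite big_ord_recr/= IH; ring.
Qed.

End scalars.

Variables (G1 G0 : lie_group R) (G : lie_2group G1 G0).
Variables (X E1 E0 : manifold R) (E : lie_groupoid E1 E0).
Variable P : principal_2bundle G (discrete_groupoid X) E.

Let pi1 : E1 -> X := bundle_proj1 P.
Let pi0 : E0 -> X := bundle_proj0 P.

(** The gauge forms are total functions without meaning outside [U]. Multiplied by [rho] they are a
    connection of weight [rho] over [U] and the zero connection of weight 0 over [W], and these two
    sets cover X. *)
Lemma local_connection (b : X) : exists rho (V : set X) eta theta,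
  [/\ smooth_scalar rho, [/\ open V, V b & forall x, V x -> rho x = 1] &
      weighted_connection P setT rho eta theta].
Proof.
have [U [gamma1 [gamma0 [oU Ub gg]]]] := gauge_exists P b.
have [rho [V [W [srho Vb [oW W0 UW]]]]] := manifold_cutoff oU Ub.
exists rho, V, (fun a v => rho (pi1 a) *: gauge_form gamma1 v),
  (fun x v => rho (pi0 x) *: gauge_form gamma0 v); split=> //.
apply: weighted_connection_local => y _; have [Uy|Wy] := UW y.
  exists U; split=> //.
  have := weighted_connectionZ oU srho (gauge_connection oU gg).
  by apply: weighted_connection_ext => // x _; rewrite mulr1.
exists W; split=> //; apply: weighted_connection_ext (weighted_connection0 P W) => //.
- by move=> x /W0.
- by move=> a v /W0 r0; rewrite [rho _]r0 scale0r.
- by move=> x v /W0 r0; rewrite [rho _]r0 scale0r.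
Qed.

Section partition.
Variables (rho : nat -> X -> R) (V : nat -> set X).
Variables (eta : nat -> forall a : E1, tangent E1 a -> lie_algebra G1).
Variables (theta : nat -> forall x : E0, tangent E0 x -> lie_algebra G0).
Hypothesis rho_smooth : forall n, smooth_scalar (rho n).
Hypothesis V_open : forall n, open (V n).
Hypothesis rho1 : forall n x, V n x -> rho n x = 1.
Hypothesis V_cover : forall x, exists n, V n x.
Hypothesis conn : forall n, weighted_connection P setT (rho n) (eta n) (theta n).

(** The forms [eta i] already carry the weight [rho i], so the coefficient is [leftover rho i]
    alone. *)
Let sum1 n (a : E1) (v : tangent E1 a) : lie_algebra G1 :=
  \sum_(i < n) leftover rho i (pi1 a) *: eta i v.
Let sum0 n (x : E0) (v : tangent E0 x) : lie_algebra G0 :=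
  \sum_(i < n) leftover rho i (pi0 x) *: theta i v.

Let sum_connection n : weighted_connection P setT
  (fun x => \sum_(i < n) leftover rho i x * rho i x) (sum1 n) (sum0 n).
Proof.
elim: n => [|n IH].
  apply: weighted_connection_ext (weighted_connection0 P setT);
    by [exact: openT|move=> *; rewrite /sum1 /sum0 big_ord0].
apply: weighted_connection_ext (weighted_connectionD openT IH
  (weighted_connectionZ openT (smooth_leftover n rho_smooth) (conn n)));
  by [exact: openT|move=> *; rewrite /sum1 /sum0 big_ord_recr].
Qed.

Let sum_stable (T : lmodType R) (F : nat -> T) m n x : V m x -> (m < n)%N ->
  \sum_(i < n) leftover rho i x *: F i = \sum_(i < m.+1) leftover rho i x *: F i.
Proof.
move=> Vx mn; rewrite -!(big_mkord xpredT (fun i => leftover rho i x *: F i)).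
rewrite (big_cat_nat (leq0n _) mn) /= [X in _ + X]big_nat_cond [X in _ + X]big1 ?addr0//.
move=> i; rewrite andbT => /andP[mi _].
by rewrite (leftover_eq0 (rho1 Vx) mi) scale0r.
Qed.

Let sum_indep (T : lmodType R) (F : nat -> T) m n x : V m x -> V n x ->
  \sum_(i < n.+1) leftover rho i x *: F i = \sum_(i < m.+1) leftover rho i x *: F i.
Proof.
move=> Vm Vn; have [mn|mn] := leqP m n.
  by rewrite (sum_stable _ Vm)// ltnS.
by rewrite [RHS](sum_stable _ Vn)// ltnS ltnW.
Qed.

Lemma glued_connection : exists eta' theta',
  weighted_connection P setT (fun=> 1) eta' theta'.
Proof.
have [N VN] := choice V_cover.
(* [N] is an arbitrary choice, not locally constant. On the open set V (N b) the sum cut at the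
   varying index agrees with the one cut at the fixed index N b, by [sum_indep]; the successor
   includes the index itself. *)
exists (fun a => @sum1 (N (pi1 a)).+1 a), (fun x => @sum0 (N (pi0 x)).+1 x).
apply: weighted_connection_local => b _; exists (V (N b)); split=> //.
have := sum_connection (N b).+1.
have sub f e t : weighted_connection P setT f e t ->
    weighted_connection P (V (N b)) f e t.
  by move=> w; apply: weighted_connection_local => y _; exists setT.
move=> /sub; apply: weighted_connection_ext => //.
- by move=> x Vx; rewrite sum_leftover (leftover_eq0 (rho1 Vx)) ?subr0.
- by move=> a v Va; exact: (sum_indep (fun i => eta i v) (VN _) Va).
- by move=> x v Vx; exact: (sum_indep (fun i => theta i v) (VN _) Vx).
Qed.

End partition.

End gluing.

Theorem corollary5p21 (R : realType) (G1 G0 : lie_group R)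
    (G : lie_2group G1 G0) (X : manifold R) (E1 E0 : manifold R)
    (E : lie_groupoid E1 E0)
    (P : principal_2bundle G (discrete_groupoid X) E) :
  exists (omega1 : forall a : E1, tangent E1 a -> lie_algebra G1)
         (omega0 : forall x : E0, tangent E0 x -> lie_algebra G0),
    strict_connection P omega1 omega0.
Proof.
suff [eta [theta w]] : exists eta theta,
    weighted_connection P setT (fun=> 1) eta theta.
  by exists eta, theta; exact: strict_connection_weighted.
have /choice[rho /choice[V /choice[eta /choice[theta D]]]] := local_connection P.
have HV b : nbhs b (V b).
  by have [_ [oV Vb _] _] := D b; exact: open_nbhs_nbhs.
have [c cV] := second_countable_lindelof (manifold_second_countable X) HV.
pose at_ T (t0 : T) (t : X -> T) n := if c n is Some b then t b else t0.
apply: (@glued_connection _ _ _ _ _ _ _ _ P (at_ _ (fun=> 0) rho)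
  (at_ _ set0 V) (at_ _ (fun _ _ => 0) eta) (at_ _ (fun _ _ => 0) theta)).
- move=> n; rewrite /at_; case: (c n) => [b|]; first by have [] := D b.
  exact: smooth_scalar_cst.
- move=> n; rewrite /at_; case: (c n) => [b|]; last exact: open0.
  by have [_ []] := D b.
- by move=> n x; rewrite /at_; case: (c n) => [b|//]; have [_ [_ _ H] _] := D b; exact: H.
- by move=> x; have [n [b [cn Vx]]] := cV x; exists n; rewrite /at_ cn.
- move=> n; rewrite /at_; case: (c n) => [b|]; first by have [] := D b.
  exact: weighted_connection0.
Qed.
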